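(* Let $\mu$ and $\mu_{-1}$ be non-trivial probability measures on the unit circle $\mathbb{T}$ with real recurrence coefficients $\{\alpha_k\}_{k\ge 0}$ and $\{-\alpha_k\}_{k\ge 0}$, respectively. If both $\mu$ and $\mu_{-1}$ belong to the Steklov class $\mathcal{S}$, then $$ \sup_{n > \ell \ge 0} \left(\frac{1}{n - \ell}\sum_{k=\ell}^{n-1} e^{2s_k}\right) \left(\frac{1}{n - \ell}\sum_{k=\ell}^{n-1} e^{-2s_k}\right) < \infty, $$ where $s_k = \alpha_0 + \alpha_1 + \ldots + \alpha_k$ for integers $k \ge 0$ and the supremum is over all integers $n>\ell\ge 0$.
   Context: Let $\mathbb{T}=\{z\in\mathbb{C}: |z|=1\}$ and let $m$ be the Lebesgue measure on $\mathbb{T}$ normalized by $m(\mathbb{T})=1$. A probability measure on $\mathbb{T}$ is non-trivial if its support is an infinite set. Recurrence coefficients: for a non-trivial probability measure $\mu$, let $\Phi_n$ ($n\ge 0$) be the monic polynomials with $\deg \Phi_n=n$ that are pairwise orthogonal in $L^2(\mu)$. They satisfy $\Phi_{n+1}(z) = z\Phi_n(z)-\overline{\alpha_n}\,\Phi_n^*(z)$, $\Phi_0\equiv 1$, where $\Phi_n^*(z)=z^n\overline{\Phi_n(1/\bar z)}$. The numbers $\alpha_n=-\overline{\Phi_{n+1}(0)}$, $n \ge 0$, are the recurrence coefficients of $\mu$; they satisfy $|\alpha_n|<1$, and every sequence of complex numbers $\alpha_n$ with $|\alpha_n|<1$ is the sequence of recurrence coefficients of a unique non-trivial probability measure on $\mathbb{T}$.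 Steklov class: a measure $\mu=w\,dm+\mu_s$ (Lebesgue decomposition, $\mu_s$ singular with respect to $m$) belongs to the Steklov class $\mathcal{S}$ if $\inf_{\mathbb{T}} w>0$ (essential infimum with respect to $m$). *)

(* Defs.v *)
From HB Require Import structures.
From mathcomp Require Import all_boot all_order all_algebra complex.
From mathcomp Require Import all_classical all_reals all_analysis.
From mathcomp Require Import measurable_realfun ess_sup_inf.

Set Implicit Arguments.
Unset Strict Implicit.
Unset Printing Implicit Defensive.

Import Order.TTheory GRing.Theory Num.Theory.
Import numFieldNormedType.Exports.

Local Open Scope classical_set_scope.
Local Open Scope complex_scope.
Local Open Scope ring_scope.

(* [R[i]^o] rather than [R[i]]: only the former carries the topology of the
   complex norm. *)
Definition unit_circle (R : realType) : set (R[i]^o) :=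
  [set z : R[i]^o | `|z : R[i]| = 1].
Arguments unit_circle : clear implicits.

Definition circle (R : realType) : Type := set_type (unit_circle R).

Definition circle_val (R : realType) (z : circle R) : R[i] := \val z.

Section circle_structure.
Variable R : realType.

Lemma unit_circle1 : (1 : R[i]^o) \in unit_circle R.
Proof. by rewrite inE /unit_circle /= normr1. Qed.

HB.instance Definition _ := Choice.on (circle R).
HB.instance Definition _ := isPointed.Build (circle R)
  (@exist _ (fun z => z \in unit_circle R) _ unit_circle1).
HB.instance Definition _ :=
  Topological.copy (circle R) (set_type (unit_circle R)).

HB.instance Definition _ :=
  Measurable.copy (circle R) (g_sigma_algebraType (@open (circle R))).

End circle_structure.

Section normalized_lebesgue.
Variable R : realType.

Lemma expi_subproof (t : R) :
  (cos (2 * pi * t) +i* sin (2 * pi * t) : R[i]^o) \in unit_circle R.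
Proof.
by rewrite inE /unit_circle /= normc_def /= cos2Dsin2 sqrtr1.
Qed.

Definition expi (t : R) : circle R :=
  @exist _ (fun z => z \in unit_circle R) _ (expi_subproof t).

Lemma continuous_expi : continuous expi.
Proof.
suff cf : continuous (fun t : R =>
    (cos (2 * pi * t) +i* sin (2 * pi * t) : R[i]^o)).
  by apply/continuousP => _ [B oB <-]; exact: (continuousP _).1 cf _ oB.
move=> t; apply/cvgrPdist_lt => /= e e0.
have eE : e = (complex.Re e)%:C by rewrite RRe_real// gtr0_real.
have d0 : 0 < complex.Re e by rewrite -ltcR -eE.
have c2 : continuous (fun s : R => 2 * pi * s).
  by move=> s; apply: cvgM; [exact: cvg_cst|exact: cvg_id].
have cc : (fun s : R => cos (2 * pi * s)) @ t --> cos (2 * pi * t).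
  by apply: (@continuous_comp _ _ _ _ (@cos R)); [exact: c2|exact: continuous_cos].
have cs : (fun s : R => sin (2 * pi * s)) @ t --> sin (2 * pi * t).
  by apply: (@continuous_comp _ _ _ _ (@sin R)); [exact: c2|exact: continuous_sin].
have d20 : 0 < complex.Re e / 2 by rewrite divr_gt0.
move/cvgrPdist_lt: cc => /(_ _ d20) cc.
move/cvgrPdist_lt: cs => /(_ _ d20) cs.
near=> s.
have h1 : `|cos (2 * pi * t) - cos (2 * pi * s)| < complex.Re e / 2.
  by near: s.
have h2 : `|sin (2 * pi * t) - sin (2 * pi * s)| < complex.Re e / 2.
  by near: s.
set a := (X in `|X| < _) in h1; set b := (X in `|X| < _) in h2.
have -> : (cos (2 * pi * t) +i* sin (2 * pi * t) : R[i]) -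
    (cos (2 * pi * s) +i* sin (2 * pi * s)) = a +i* b by [].
rewrite eE normc_def ltcR /=.
rewrite -[ltRHS]ger0_norm ?(ltW d0)// -sqrtr_sqr ltr_sqrt ?exprn_gt0//.
rewrite (_ : complex.Re e = complex.Re e / 2 + complex.Re e / 2); last first.
  by rewrite -splitr.
apply: (@le_lt_trans _ _ ((`|a| + `|b|) ^+ 2)).
  rewrite -[a ^+ 2]real_normK ?num_real// -[b ^+ 2]real_normK ?num_real//.
  by rewrite [leRHS]sqrrD addrAC lerDl mulrn_wge0// mulr_ge0.
by rewrite ltr_pXn2r// ?nnegrE ?addr_ge0 ?(ltW d20)// ltrD.
Unshelve. all: by end_near. Qed.

Lemma measurable_expi : measurable_fun [set: R] expi.
Proof.
apply: (@measurability _ _ _ (circle R) _ _ (@open (circle R))) => //.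
move=> _ [B oB <-]; rewrite setTI; apply: open_measurable.
exact: (continuousP _).1 continuous_expi _ oB.
Qed.

Definition unif01 : {measure set (measurableTypeR R) -> \bar R} :=
  mrestr (@lebesgue_measure R) (measurable_itv `[0%R, 1%R[).

Definition circle_lebesgue : set (circle R) -> \bar R := pushforward unif01 expi.

Let circle_lebesgue0 : circle_lebesgue set0 = 0%E.
Proof. by rewrite /circle_lebesgue /pushforward preimage_set0 measure0. Qed.

Let circle_lebesgue_ge0 A : (0 <= circle_lebesgue A)%E.
Proof. exact: (measure_ge0 unif01). Qed.

Let circle_lebesgue_sigma_additive : semi_sigma_additive circle_lebesgue.
Proof. by apply: measure_semi_sigma_additive; exact: measurable_expi. Qed.

HB.instance Definition _ := isMeasure.Build _ _ _ circle_lebesgue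
  circle_lebesgue0 circle_lebesgue_ge0 circle_lebesgue_sigma_additive.

Let circle_lebesgue_setT : circle_lebesgue [set: circle R] = 1%E.
Proof.
rewrite /circle_lebesgue /pushforward preimage_setT /unif01 /= /mrestr setTI.
by rewrite lebesgue_measure_itv /= lte_fin ltr01 oppr0 adde0.
Qed.

HB.instance Definition _ :=
  Measure_isProbability.Build _ _ _ circle_lebesgue circle_lebesgue_setT.

End normalized_lebesgue.
Arguments circle_lebesgue : clear implicits.

Section opuc.
Variable R : realType.
Implicit Types mu nu : {measure set (circle R) -> \bar R}.

Definition msupport mu : set (circle R) :=
  [set z | forall U : set (circle R), open U -> U z -> (0 < mu U)%E].

Definition nontrivial mu := infinite_set (msupport mu).

Definition cintegral mu (f : circle R -> R[i]) : R[i] :=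
  (\int[mu]_z complex.Re (f z)) +i* (\int[mu]_z complex.Im (f z)).

Definition pinner mu (p q : {poly R[i]}) : R[i] :=
  cintegral mu (fun z => p.[circle_val z] * (q.[circle_val z])^*).

Definition monic_orthogonal mu (Phi : nat -> {poly R[i]}) :=
  [/\ forall n, Phi n \is monic,
      forall n, size (Phi n) = n.+1 &
      forall m n, m != n -> pinner mu (Phi m) (Phi n) = 0].

(* For nontrivial [mu] exactly one such [Phi] exists. *)
Definition recurrence_coefficients mu (alpha : nat -> R[i]) :=
  exists2 Phi : nat -> {poly R[i]}, monic_orthogonal mu Phi &
    forall n, alpha n = - ((Phi n.+1).[0])^*.

Definition mutually_singular mu nu :=
  exists N : set (circle R), [/\ measurable N, mu (~` N) = 0%E & nu N = 0%E].

Definition lebesgue_decomposition mu (w : circle R -> R)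
    (mus : {measure set (circle R) -> \bar R}) :=
  [/\ measurable_fun [set: circle R] w, forall z, 0 <= w z,
      mutually_singular mus (circle_lebesgue R) &
      forall A : set (circle R), measurable A ->
        mu A = (\int[circle_lebesgue R]_(z in A) (w z)%:E + mus A)%E].

(* The decomposition determines [mus], and [w] up to a.e. equality. *)
Definition steklov mu :=
  exists (w : circle R -> R) (mus : {measure set (circle R) -> \bar R}),
    lebesgue_decomposition mu w mus /\
    (0 < ess_inf (circle_lebesgue R) (EFin \o w))%E.

Definition partial_sum (alpha : nat -> R) (k : nat) : R :=
  \sum_(0 <= j < k.+1) alpha j.

End opuc.

(* Main.v *)
Require Import Defs.
From mathcomp Require Import all_boot all_order all_algebra complex.
From mathcomp Require Import all_classical all_reals all_analysis.
From mathcomp Require Import measurable_realfun ess_sup_inf.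
From mathcomp Require Import zify ring lra.

Import Order.TTheory GRing.Theory Num.Theory.
Import numFieldNormedType.Exports.

Local Open Scope classical_set_scope.
Local Open Scope complex_scope.
Local Open Scope ring_scope.

(* Fix l < n, N = n - l and r = N / (N + 1).  For real z = r the pair
   (Phi_k(r), Phi_k^*(r)) solves a real two-dimensional recursion; its second
   solution (y_k, ys_k), decaying like r ^ k, is given by the integrals of
   Phi_k / (e - r) and Phi_k^* / (e - r) against mu.

   The Steklov bound for mu controls the Christoffel functions at r and 1 / r,
   hence the sums over l < k <= n of Phi_k(r)^2 and Phi_k^*(r)^2 are O(N).  By
   orthogonality and Bessel's inequality the sums of (y_k / r ^ l)^2 and
   (ys_k / r ^ l)^2 are at most the integral of 1 / |e - r|^2, i.e. a Poisson
   integral of mu over 1 - r ^ 2; since the Caratheodory functions of mu and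
   mu_{-1} are inverse to each other, the Steklov bound for mu_{-1} makes this
   O(N) too.

   In the coordinates Phi_k^* + Phi_k and Phi_k^* - Phi_k, divided by
   P_k = prod (1 - alpha_j) and Q_k = prod (1 + alpha_j), let L_k and K_k be the
   sums of the absolute values over the two solutions.  The recursion gives
   L_{k+1} <= L_k + (1 - r) / 2 * (Q_k / P_k) * K_k, and L_k K_k is bounded below
   by the Wronskian, so that L_{k+1} / L_k <= 1 + O(1 / N) (Q_k / P_k) K_k^2.
   As the sum of (Q_k / P_k) K_k^2 is O(N), L_n = O(L_k) on the whole interval,
   and likewise K_n = O(K_k).  Hence the sums of P_k / Q_k and Q_k / P_k are
   O(N / L_n^2) and O(N / K_n^2), and L_n K_n is bounded below.  Finally
   P_k / Q_k is comparable to exp (- 2 s_{k-1}), the product P_k Q_k being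
   the squared norm of Phi_k, which lies between a positive constant and 1. *)

(** * Solutions of the Szego recursion *)

Definition szego_solution {R : realType} (a : nat -> R) (r : R) (x xs : nat -> R) :=
  forall k, x k.+1 = r * x k - a k * xs k /\ xs k.+1 = xs k - a k * r * x k.

Section szego_recursion.
Context {R : realType}.
Implicit Types (a x xs y ys : nat -> R) (r : R).

(** The squared norm of Phi_k in L^2(mu), as shown in [ip_sf_norm]. *)
Definition szego_norm a k := \prod_(j < k) (1 - a j ^+ 2).

(** The symmetry alpha -> - alpha: it interchanges [xs + x] and [xs - x], and turns solutions
    attached to mu_{-1} into solutions attached to mu. *)
Lemma szego_solution_opp a r x xs : szego_solution a r x xs ->
  szego_solution (\- a) r (\- x) xs.
Proof. by move=> s k; have [/= -> ->] := s k; split; ring. Qed.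

Lemma szego_solutionZ a r x xs t : szego_solution a r x xs ->
  szego_solution a r (fun k => t * x k) (fun k => t * xs k).
Proof. by move=> s k; have [/= -> ->] := s k; split; ring. Qed.

Lemma szego_norm_opp a k : szego_norm (\- a) k = szego_norm a k.
Proof. by apply: eq_bigr => i _; rewrite /= sqrrN. Qed.

Lemma szego_normS a k : szego_norm a k.+1 = szego_norm a k * (1 - a k ^+ 2).
Proof. by rewrite /szego_norm big_ord_recr. Qed.

(** One step of the recursion is a linear map of determinant [r * (1 - a k ^+ 2)]. *)
Lemma wronskian a r x xs y ys k :
  szego_solution a r x xs -> szego_solution a r y ys ->
  xs k * y k - x k * ys k =
  r ^+ k * szego_norm a k * (xs 0%N * y 0%N - x 0%N * ys 0%N).
Proof.
move=> sx sy; elim: k => [|k IHk]; first by rewrite /szego_norm big_ord0; ring.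
have [-> ->] := sx k; have [-> ->] := sy k; rewrite szego_normS exprS.
transitivity (r * (1 - a k ^+ 2) * (xs k * y k - x k * ys k)); first by ring.
by rewrite IHk; ring.
Qed.

Section bounded.
Variables (a : nat -> R) (c : R).
Hypotheses (a_lt1 : forall k, `|a k| < 1) (c_gt0 : 0 < c)
  (c_le : forall k, c <= szego_norm a k).

Let P k := \prod_(j < k) (1 - a j).
Let Q k := \prod_(j < k) (1 + a j).

Let P_gt0 k : 0 < P k.
Proof. by apply: prodr_gt0 => i _; have := a_lt1 i; rewrite ltr_norml; lra. Qed.

Let Q_gt0 k : 0 < Q k.
Proof. by apply: prodr_gt0 => i _; have := a_lt1 i; rewrite ltr_norml; lra. Qed.

Let PQ k : P k * Q k = szego_norm a k.
Proof. by rewrite -big_split /=; apply: eq_bigr => i _; ring. Qed.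

Lemma szego_norm_le1 k : szego_norm a k <= 1.
Proof.
apply: prodr_ile1 => i _; have := a_lt1 i; rewrite ltr_norml => /andP[? ?].
by apply/andP; split; nra.
Qed.

Let PE k : P k * expR (\sum_(j < k) a j) <= 1.
Proof.
rewrite expR_sum -big_split /=; apply: prodr_ile1 => i _; apply/andP; split.
  by apply: mulr_ge0; [have := a_lt1 i; rewrite ltr_norml; lra|exact: expR_ge0].
have := expR_ge1Dx (- a i); rewrite expRN => h.
by rewrite -ler_pdivlMr ?expR_gt0// mul1r.
Qed.

Let QE k : Q k * expR (- \sum_(j < k) a j) <= 1.
Proof.
rewrite -sumrN expR_sum -big_split /=; apply: prodr_ile1 => i _; apply/andP; split.
  by apply: mulr_ge0; [have := a_lt1 i; rewrite ltr_norml; lra|exact: expR_ge0].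
have := expR_ge1Dx (a i) => h.
by rewrite expRN -ler_pdivlMr ?invr_gt0 ?expR_gt0// mul1r invrK.
Qed.

(** With s the partial sum, 1 + t <= exp t gives Q <= exp s; together with c <= P Q this yields c
    exp (- s) <= P. The product of the two estimates is the claim. *)
Lemma expR_partial_sum_le k :
  expR (- 2 * partial_sum a k) <= c^-1 * (P k.+1 / Q k.+1).
Proof.
rewrite /partial_sum big_mkord; set s := \sum_(_ < _) _.
have q : expR (- s) <= (Q k.+1)^-1.
  by rewrite -[leRHS]mul1r ler_pdivlMr// mulrC QE.
have cp : c * expR (- s) <= P k.+1.
  have h := c_le k.+1; rewrite -PQ in h.
  apply: (le_trans (ler_wpM2r (expR_ge0 _) h)).
  by rewrite -mulrA -[leRHS]mulr1 ler_wpM2l ?QE// ltW.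
rewrite (_ : - 2 * s = - s + - s); last by ring.
rewrite expRD mulrA; apply: ler_pM; rewrite ?expR_ge0//.
by rewrite mulrC ler_pdivlMr// mulrC.
Qed.

(** * Growth of the weighted norms on one interval *)

Section interval.
Variables (C d : R) (l n : nat) (x xs y ys : nat -> R).
Let N : R := (n - l)%N%:R.
Let r := N / (N + 1).
Hypotheses (ltln : (l < n)%N) (d_gt0 : 0 < d).
Hypotheses (sx : szego_solution a r x xs) (sy : szego_solution a r y ys).
Hypotheses (x2 : \sum_(l.+1 <= k < n.+1) x k ^+ 2 <= C * N)
  (xs2 : \sum_(l.+1 <= k < n.+1) xs k ^+ 2 <= C * N)
  (y2 : \sum_(l.+1 <= k < n.+1) y k ^+ 2 <= C * N)
  (ys2 : \sum_(l.+1 <= k < n.+1) ys k ^+ 2 <= C * N)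
  (d_le : forall k, (l < k <= n)%N -> d <= `|xs k * y k - x k * ys k|).

Let u k := `|xs k + x k| + `|ys k + y k|.
Let v k := `|xs k - x k| + `|ys k - y k|.
Let lam k := u k / P k.
Let kap k := v k / Q k.

Let N_gt0 : 0 < N.
Proof. by rewrite ltr0n subn_gt0. Qed.

Let rE : 1 - r = (N + 1)^-1.
Proof. by have := N_gt0; rewrite /r => ?; field; rewrite gt_eqF//; lra. Qed.

Let r01 : 0 <= r <= 1.
Proof.
apply/andP; split; first by rewrite /r divr_ge0// ltW// addr_gt0// N_gt0.
by rewrite -subr_ge0 rE invr_ge0 ltW// addr_gt0// N_gt0.
Qed.

(** The new sum is (1 - a k) (zs + r z), and zs + r z = (1 + r) / 2 (zs + z) + (1 - r) / 2 (zs - z);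
    the factor 1 - a k is absorbed by P. *)
Let lamS k : lam k.+1 <= lam k + (1 - r) / 2 * (Q k / P k) * kap k.
Proof.
have Pk := P_gt0 k; have Qk := Q_gt0 k.
have a1 : 0 < 1 - a k by have := a_lt1 k; rewrite ltr_norml; lra.
rewrite /lam /kap ler_pdivrMr//.
have -> : P k.+1 = P k * (1 - a k) by rewrite /P big_ord_recr.
have -> : (u k / P k + (1 - r) / 2 * (Q k / P k) * (v k / Q k)) *
    (P k * (1 - a k)) = (1 - a k) * (u k + (1 - r) / 2 * v k).
  by field; rewrite !gt_eqF.
have step z zs : szego_solution a r z zs -> `|zs k.+1 + z k.+1| <=
    (1 - a k) * (`|zs k + z k| + (1 - r) / 2 * `|zs k - z k|).
  move=> sz; have [-> ->] := sz k.
  have -> : zs k - a k * r * z k + (r * z k - a k * zs k) =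
    (1 - a k) * ((1 + r) / 2 * (zs k + z k) + (1 - r) / 2 * (zs k - z k)).
    by field.
  rewrite normrM (gtr0_norm a1) ler_pM2l//.
  apply: (le_trans (ler_normD _ _)); apply: lerD; rewrite normrM.
    by rewrite ger0_norm ?ler_piMl//; have := r01; lra.
  by rewrite ger0_norm//; have := r01; lra.
have := lerD (step _ _ sx) (step _ _ sy); rewrite /u /v; lra.
Qed.

Let u_ge0 k : 0 <= u k. Proof. exact: addr_ge0. Qed.
Let v_ge0 k : 0 <= v k. Proof. exact: addr_ge0. Qed.
Let lam_ge0 k : 0 <= lam k. Proof. by rewrite divr_ge0// ltW. Qed.
Let kap_ge0 k : 0 <= kap k. Proof. by rewrite divr_ge0// ltW. Qed.

(** Twice the Wronskian is (xs - x) (ys + y) - (xs + x) (ys - y), hence at most [u k * v k];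
    dividing by P Q <= 1 can only increase this. *)
Lemma weighted_norm_mul_ge k : (l < k <= n)%N -> 2 * d <= lam k * kap k.
Proof.
move=> /d_le h; have Pk := P_gt0 k; have Qk := Q_gt0 k.
rewrite /lam /kap mulf_div ler_pdivlMr ?mulr_gt0// PQ.
apply: (@le_trans _ _ (2 * d)).
  by rewrite ler_piMr ?szego_norm_le1// mulr_ge0// ltW.
have : `|2 * (xs k * y k - x k * ys k)| <= u k * v k.
  rewrite (_ : 2 * _ = (xs k - x k) * (ys k + y k) - (xs k + x k) * (ys k - y k)).
    2: by ring.
  apply: (le_trans (ler_normB _ _)); rewrite !normrM /u /v.
  have := mulr_ge0 (normr_ge0 (xs k - x k)) (normr_ge0 (xs k + x k)).
  have := mulr_ge0 (normr_ge0 (ys k - y k)) (normr_ge0 (ys k + y k)).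
  by lra.
by rewrite normrM ger0_norm//; lra.
Qed.

Let sum_sqr (w : nat -> R) : (forall k, 0 <= w k) ->
  (forall k, w k ^+ 2 <= 4 * (x k ^+ 2 + xs k ^+ 2 + y k ^+ 2 + ys k ^+ 2)) ->
  \sum_(l.+1 <= k < n.+1) w k ^+ 2 / szego_norm a k <= 16 * C / c * N.
Proof.
move=> w0 hw.
apply: (@le_trans _ _ (\sum_(l.+1 <= k < n.+1)
    4 / c * (x k ^+ 2 + xs k ^+ 2 + y k ^+ 2 + ys k ^+ 2))).
  apply: ler_sum => k _.
  apply: (@le_trans _ _ (w k ^+ 2 / c)).
    by rewrite ler_wpM2l ?sqr_ge0// lef_pV2// posrE// (lt_le_trans c_gt0).
  by rewrite [leRHS]mulrAC ler_wpM2r// invr_ge0 ltW.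
rewrite -mulr_sumr !big_split /=.
rewrite (_ : 16 * C / c * N = 4 / c * (C * N + C * N + C * N + C * N)).
  2: by field; rewrite gt_eqF.
by apply: ler_wpM2l; [rewrite divr_ge0// ltW|rewrite !lerD].
Qed.

Let u2 k : u k ^+ 2 <= 4 * (x k ^+ 2 + xs k ^+ 2 + y k ^+ 2 + ys k ^+ 2).
Proof.
have e1 := real_normK (num_real (xs k + x k)).
have e2 := real_normK (num_real (ys k + y k)).
have := sqr_ge0 (`|xs k + x k| - `|ys k + y k|).
have := sqr_ge0 (xs k - x k); have := sqr_ge0 (ys k - y k).
rewrite /u; nra.
Qed.

Let v2 k : v k ^+ 2 <= 4 * (x k ^+ 2 + xs k ^+ 2 + y k ^+ 2 + ys k ^+ 2).
Proof.
have e1 := real_normK (num_real (xs k - x k)).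
have e2 := real_normK (num_real (ys k - y k)).
have := sqr_ge0 (`|xs k - x k| - `|ys k - y k|).
have := sqr_ge0 (xs k + x k); have := sqr_ge0 (ys k + y k).
rewrite /v; nra.
Qed.

Let C_ge0 : 0 <= C.
Proof.
rewrite -(pmulr_lge0 _ N_gt0) (le_trans _ x2)//.
by apply: sumr_ge0 => k _; exact: sqr_ge0.
Qed.

Let E := 4 * C / (c * d).

(** A discrete Gronwall argument: the relative increments [ep] add up to at most [E * r], because (1
    - r) N = r. *)
Let lam_n k : (l < k <= n)%N -> lam n <= expR E * lam k.
Proof.
move=> /andP[lk kn].
(* The increment in [lamS] is multiplied by lam kap / (2 d) >= 1 to become proportional to lam; then
   (Q / P) kap ^ 2 = v ^ 2 / (P Q). *)
pose ep i := (1 - r) / (4 * d) * (v i ^+ 2 / szego_norm a i).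
have ep_ge0 i : 0 <= ep i.
  rewrite mulr_ge0// ?divr_ge0 ?sqr_ge0//.
  - by have := r01; lra.
  - by rewrite mulr_ge0// ltW.
  - by rewrite (le_trans (ltW c_gt0)).
have stp i : (l < i <= n)%N -> lam i.+1 <= expR (ep i) * lam i.
  move=> /weighted_norm_mul_ge h; apply: (le_trans (lamS i)).
  apply: (@le_trans _ _ ((1 + ep i) * lam i)); last first.
    by rewrite ler_wpM2r// expR_ge1Dx.
  rewrite [leRHS]mulrDl mul1r lerD2l.
  have Pi := P_gt0 i; have Qi := Q_gt0 i.
  have -> : ep i * lam i =
     (1 - r) / 2 * (Q i / P i) * kap i * (lam i * kap i / (2 * d)).
    by rewrite /ep -PQ /kap; field; rewrite !gt_eqF.
  rewrite ler_peMr//; last by rewrite ler_pdivlMr ?mul1r// mulr_gt0.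
  rewrite mulr_ge0// mulr_ge0//; last by rewrite divr_ge0// ltW.
  by have := r01; lra.
have main m : (k <= m <= n)%N -> lam m <= expR (\sum_(k <= i < m) ep i) * lam k.
  elim: m => [|m IHm] /andP[].
    by rewrite leqn0 => /eqP -> _; rewrite big_geq// expR0 mul1r.
  rewrite leq_eqVlt => /predU1P[<- _|]; first by rewrite big_geq// expR0 mul1r.
  rewrite ltnS => km mn.
  rewrite big_nat_recr//= addrC expRD -mulrA.
  apply: (le_trans (stp m _)); first by rewrite (leq_trans lk km) ltnW.
  by rewrite ler_wpM2l ?expR_ge0// IHm// km ltnW.
apply: (le_trans (main n _)); first by rewrite kn leqnn.
rewrite ler_wpM2r// ler_expR.
apply: (@le_trans _ _ (\sum_(l.+1 <= i < n.+1) ep i)).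
  rewrite (@big_cat_nat _ _ _ k l.+1 n.+1)//=; last exact: leqW.
  rewrite big_nat_recr//= addrA addrAC lerDr addr_ge0// sumr_ge0//.
rewrite -mulr_sumr; have h := sum_sqr _ v_ge0 v2.
apply: (@le_trans _ _ ((1 - r) / (4 * d) * (16 * C / c * N))).
  by rewrite ler_wpM2l// divr_ge0//; [have := r01; lra|rewrite mulr_ge0// ltW].
have -> : (1 - r) / (4 * d) * (16 * C / c * N) = E * r.
  by rewrite rE /r /E; have := N_gt0 => ?; field; rewrite !gt_eqF//; lra.
by rewrite ler_piMr// ?divr_ge0 ?mulr_ge0 ?(ltW c_gt0) ?(ltW d_gt0)//; have := r01; lra.
Qed.

Lemma sum_ratio_weighted_norm_le : (\sum_(l.+1 <= k < n.+1) P k / Q k) * lam n ^+ 2 <=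
  expR E ^+ 2 * (16 * C / c * N).
Proof.
have e2 : 0 <= expR E ^+ 2 by rewrite exprn_ge0// expR_ge0.
apply: (le_trans _ (ler_wpM2l e2 (sum_sqr _ u_ge0 u2))).
rewrite mulr_suml mulr_sumr !big_nat; apply: ler_sum => k /andP[lk kn].
have Pk := P_gt0 k; have Qk := Q_gt0 k.
have -> : u k ^+ 2 / szego_norm a k = P k / Q k * lam k ^+ 2.
  by rewrite /lam -PQ; field; rewrite !gt_eqF.
rewrite [leRHS]mulrCA; apply: ler_wpM2l; first by rewrite divr_ge0// ltW.
rewrite -exprMn; apply: lerXn2r; rewrite ?nnegrE//.
  by rewrite mulr_ge0 ?expR_ge0.
by apply: lam_n; rewrite lk.
Qed.

End interval.
End bounded.

Lemma sum_expR_le a (c C d : R) l n x xs y ys (N := (n - l)%N%:R) (r := N / (N + 1)) :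
  (forall k, `|a k| < 1) -> 0 < c -> (forall k, c <= szego_norm a k) ->
  (l < n)%N -> 0 < d ->
  szego_solution a r x xs -> szego_solution a r y ys ->
  \sum_(l.+1 <= k < n.+1) x k ^+ 2 <= C * N ->
  \sum_(l.+1 <= k < n.+1) xs k ^+ 2 <= C * N ->
  \sum_(l.+1 <= k < n.+1) y k ^+ 2 <= C * N ->
  \sum_(l.+1 <= k < n.+1) ys k ^+ 2 <= C * N ->
  (forall k, (l < k <= n)%N -> d <= `|xs k * y k - x k * ys k|) ->
  (N^-1 * \sum_(l <= k < n) expR (2 * partial_sum a k)) *
  (N^-1 * \sum_(l <= k < n) expR (- 2 * partial_sum a k)) <=
  (expR (4 * C / (c * d)) ^+ 2 * (16 * C / c) / (2 * d * c)) ^+ 2.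
Proof.
move=> a1 c0 cN ln d0 sx sy x2 xs2 y2 ys2 dW.
have a1' k : `|(\- a) k| < 1 by rewrite /= normrN.
have cN' k : c <= szego_norm (\- a) k by rewrite szego_norm_opp.
have sqN (w : nat -> R) : \sum_(l.+1 <= k < n.+1) (\- w) k ^+ 2 =
    \sum_(l.+1 <= k < n.+1) w k ^+ 2 by apply: eq_bigr => k _; rewrite /= sqrrN.
have dW' k : (l < k <= n)%N -> d <= `|xs k * (\- y) k - (\- x) k * ys k|.
  by move=> /dW; rewrite /= mulrN mulNr -opprB normrN opprK addrC.
have N0 : 0 < N by rewrite ltr0n subn_gt0.
pose P k := \prod_(j < k) (1 - a j); pose Q k := \prod_(j < k) (1 + a j).
have PN k : \prod_(j < k) (1 - (\- a) j) = Q k.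
  by apply: eq_bigr => j _; rewrite /= opprK.
set D := expR (4 * C / (c * d)) ^+ 2 * (16 * C / c).
pose L := (`|xs n + x n| + `|ys n + y n|) / P n.
pose K := (`|xs n - x n| + `|ys n - y n|) / Q n.
have hL : (\sum_(l.+1 <= k < n.+1) P k / Q k) * L ^+ 2 <= D * N.
  by rewrite /D -mulrA; exact: (@sum_ratio_weighted_norm_le a c a1 c0 cN C d l n x xs y ys).
(* For - a the products P and Q trade places, so the bound on [lam] becomes one on [kap]. *)
have hK : (\sum_(l.+1 <= k < n.+1) Q k / P k) * K ^+ 2 <= D * N.
  have := @sum_ratio_weighted_norm_le (\- a) c a1' c0 cN' C d l n (\- x) xs (\- y) ys ln d0
    (szego_solution_opp _ _ _ _ sx) (szego_solution_opp _ _ _ _ sy).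
  rewrite !sqN => /(_ x2 xs2 y2 ys2 dW').
  rewrite PN (_ : D * N = expR (4 * C / (c * d)) ^+ 2 * (16 * C / c * N)); last exact/esym/mulrA.
  move=> h; apply: le_trans h; apply: ler_wpM2r; first exact: sqr_ge0.
  by apply: ler_sum => k _; rewrite PN.
have hLK : 2 * d <= L * K.
  by have := @weighted_norm_mul_ge a a1 d l n x xs y ys d0 dW n; rewrite ln leqnn => /(_ isT).
set S1 := \sum_(_ <= _ < _) _ in hL; set S2 := \sum_(_ <= _ < _) _ in hK.
have P0 k : 0 < P k.
  by apply: prodr_gt0 => i _; have := a1 i; rewrite ltr_norml; lra.
have Q0 k : 0 < Q k.
  by apply: prodr_gt0 => i _; have := a1 i; rewrite ltr_norml; lra.
have S10 : 0 <= S1 by apply: sumr_ge0 => k _; rewrite divr_ge0// ltW.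
have S20 : 0 <= S2 by apply: sumr_ge0 => k _; rewrite divr_ge0// ltW.
have h1 : \sum_(l <= k < n) expR (- 2 * partial_sum a k) <= c^-1 * S1.
  (* [partial_sum a k] has k + 1 terms, so it is compared with the products at [k.+1]; hence the
     shift of the index. *)
  rewrite /S1 big_add1 /= mulr_sumr; apply: ler_sum => k _.
  exact: expR_partial_sum_le.
have h2 : \sum_(l <= k < n) expR (2 * partial_sum a k) <= c^-1 * S2.
  rewrite /S2 big_add1 /= mulr_sumr; apply: ler_sum => k _.
  have := @expR_partial_sum_le (\- a) c a1' c0 cN' k.
  by rewrite PN {1}/partial_sum sumrN mulrNN.
have S12 : S1 * S2 * (2 * d) ^+ 2 <= (D * N) ^+ 2.
  apply: (@le_trans _ _ (S1 * S2 * (L * K) ^+ 2)).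
    by rewrite ler_wpM2l ?mulr_ge0// lerXn2r ?nnegrE// ?(le_trans _ hLK) ?mulr_ge0 ?(ltW d0).
  rewrite (_ : S1 * S2 * (L * K) ^+ 2 = (S1 * L ^+ 2) * (S2 * K ^+ 2)); last by ring.
  by rewrite expr2; apply: ler_pM => //; apply: mulr_ge0 => //; exact: sqr_ge0.
apply: (@le_trans _ _ ((N^-1 * (c^-1 * S2)) * (N^-1 * (c^-1 * S1)))).
  have Nv : 0 <= N^-1 by rewrite invr_ge0 ltW.
  apply: ler_pM; rewrite ?ler_wpM2l ?mulr_ge0 ?sumr_ge0// => k _; exact: expR_ge0.
have -> : N^-1 * (c^-1 * S2) * (N^-1 * (c^-1 * S1)) =
  S1 * S2 * (2 * d) ^+ 2 / (2 * d * c * N) ^+ 2.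
  by field; rewrite !gt_eqF.
have -> : (D / (2 * d * c)) ^+ 2 = (D * N) ^+ 2 / (2 * d * c * N) ^+ 2.
  by field; rewrite !gt_eqF.
by rewrite ler_wpM2r// invr_ge0 sqr_ge0.
Qed.
End szego_recursion.

(** * Bounded measurable functions on the circle *)

Section complex_parts.
Context {R : realType}.
Implicit Types x y : R[i].

Lemma ReM x y : complex.Re (x * y) = complex.Re x * complex.Re y - complex.Im x * complex.Im y.
Proof. by case: x => a b; case: y. Qed.

Lemma ImM x y : complex.Im (x * y) = complex.Re x * complex.Im y + complex.Im x * complex.Re y.
Proof. by case: x => a b; case: y => c d /=; ring. Qed.

Lemma ReD x y : complex.Re (x + y) = complex.Re x + complex.Re y.
Proof. by case: x => a b; case: y. Qed.

Lemma ImD x y : complex.Im (x + y) = complex.Im x + complex.Im y.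
Proof. by case: x => a b; case: y. Qed.

Lemma ReJ x : complex.Re (x^*)%R = complex.Re x.
Proof. by case: x. Qed.

Lemma ImJ x : complex.Im (x^*)%R = - complex.Im x.
Proof. by case: x. Qed.

Lemma ReMJ x : complex.Re (x * x^*) = complex.Re x ^+ 2 + complex.Im x ^+ 2.
Proof. by rewrite ReM ReJ ImJ; ring. Qed.

Lemma ReMJ_ge0 x : 0 <= complex.Re (x * x^*).
Proof. by rewrite ReMJ addr_ge0// sqr_ge0. Qed.

End complex_parts.

Section bounded_measurable.
Context {R : realType}.
Implicit Types (f g : circle R -> R) (F G : circle R -> R[i]) (z : circle R).

Lemma circle_valJ z : circle_val z * (circle_val z)^* = 1.
Proof.
have := valP z; rewrite inE /unit_circle /= => z1.
by rewrite -normCK /circle_val z1 expr1n.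
Qed.

Lemma circle_val_ReIm z :
  complex.Re (circle_val z) ^+ 2 + complex.Im (circle_val z) ^+ 2 = 1.
Proof. by rewrite -ReMJ circle_valJ. Qed.

Lemma continuous_Re : continuous (fun x : R[i]^o => complex.Re x).
Proof.
move=> x; apply/(@cvgrPdist_lt _ _ _ (nbhs x)) => e e0.
have e0' : 0 < e%:C by rewrite ltcR.
have := nbhsx_ballx x _ e0'; apply: filterS => y; rewrite /ball /=.
rewrite normc_def ltcR; apply: le_lt_trans.
rewrite -[X in X <= _]sqrtr_sqr; case: x => a b; case: y => p q /=.
by rewrite ler_wsqrtr// lerDl sqr_ge0.
Qed.

Lemma continuous_Im : continuous (fun x : R[i]^o => complex.Im x).
Proof.
move=> x; apply/(@cvgrPdist_lt _ _ _ (nbhs x)) => e e0.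
have e0' : 0 < e%:C by rewrite ltcR.
have := nbhsx_ballx x _ e0'; apply: filterS => y; rewrite /ball /=.
rewrite normc_def ltcR; apply: le_lt_trans.
rewrite -[X in X <= _]sqrtr_sqr; case: x => a b; case: y => p q /=.
by rewrite ler_wsqrtr// lerDr sqr_ge0.
Qed.

Lemma continuous_circle_measurable (f : R[i]^o -> R) : continuous f ->
  measurable_fun [set: circle R] (fun z => f (circle_val z)).
Proof.
move=> /continuousP cf; apply: (measurability (@RGenOpens.G R)).
  exact: RGenOpens.measurableE.
move=> _ [B [a [b ->]] <-]; rewrite setTI; apply: sub_sigma_algebra.
exists (f @^-1` `]a, b[) => //; apply: cf; exact: interval_open.
Qed.

Definition bounded_meas f :=
  measurable_fun [set: circle R] f /\ exists M, forall z, `|f z| <= M.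

Lemma bm_cst (a : R) : bounded_meas (fun=> a).
Proof. by split; [exact: measurable_cst|exists `|a|]. Qed.

Lemma bmD f g : bounded_meas f -> bounded_meas g ->
  bounded_meas (fun z => f z + g z).
Proof.
move=> [mf [M fM]] [mg [K gK]]; split; first exact: measurable_funD.
by exists (M + K) => z; rewrite (le_trans (ler_normD _ _))// lerD.
Qed.

Lemma bmM f g : bounded_meas f -> bounded_meas g ->
  bounded_meas (fun z => f z * g z).
Proof.
move=> [mf [M fM]] [mg [K gK]]; split; first exact: measurable_funM.
by exists (M * K) => z; rewrite normrM ler_pM.
Qed.

Lemma bmN f : bounded_meas f -> bounded_meas (fun z => - f z).
Proof.
move=> [mf [M fM]]; split; first exact: measurable_funN.
by exists M => z; rewrite normrN.
Qed.

Lemma bmB f g : bounded_meas f -> bounded_meas g ->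
  bounded_meas (fun z => f z - g z).
Proof. by move=> bf bg; apply: bmD => //; exact: bmN. Qed.

Lemma bm_Re : bounded_meas (fun z => complex.Re (circle_val z)).
Proof.
split; first exact: continuous_circle_measurable continuous_Re.
exists 1 => z; have := circle_val_ReIm z.
rewrite -[X in _ <= X]sqrtr1 -sqrtr_sqr => h; rewrite ler_wsqrtr// -h lerDl sqr_ge0//.
Qed.

Lemma bm_Im : bounded_meas (fun z => complex.Im (circle_val z)).
Proof.
split; first exact: continuous_circle_measurable continuous_Im.
exists 1 => z; have := circle_val_ReIm z.
rewrite -[X in _ <= X]sqrtr1 -sqrtr_sqr => h; rewrite ler_wsqrtr// -h lerDr sqr_ge0//.
Qed.

Lemma bmV f (c : R) : 0 < c -> (forall z, c <= f z) -> bounded_meas f ->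
  bounded_meas (fun z => (f z)^-1).
Proof.
move=> c0 cf [mf _]; split; last first.
  exists c^-1 => z; have f0 : 0 < f z by exact: lt_le_trans (cf z).
  by rewrite normfV gtr0_norm// lef_pV2.
(* On positive reals the inverse is [powR] with exponent -1, whose measurability is at hand. *)
have -> : (fun z => (f z)^-1) = (fun z => powR (f z) (-1)).
  by apply/funext => z; rewrite powRN powRr1// ltW// (lt_le_trans c0).
exact: (measurableT_comp (measurable_powR _)).
Qed.

Definition cbounded_meas F := bounded_meas (fun z => complex.Re (F z)) /\
  bounded_meas (fun z => complex.Im (F z)).

Lemma cbm_cst (a : R[i]) : cbounded_meas (fun=> a).
Proof. by split; exact: bm_cst. Qed.

Lemma cbm_val : cbounded_meas (@circle_val R).
Proof. by split; [exact: bm_Re|exact: bm_Im]. Qed.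

Lemma cbmD F G : cbounded_meas F -> cbounded_meas G ->
  cbounded_meas (fun z => F z + G z).
Proof.
move=> [F1 F2] [G1 G2]; split.
  by under eq_fun do rewrite ReD; exact: bmD.
by under eq_fun do rewrite ImD; exact: bmD.
Qed.

Lemma cbmM F G : cbounded_meas F -> cbounded_meas G ->
  cbounded_meas (fun z => F z * G z).
Proof.
move=> [F1 F2] [G1 G2]; split.
  by under eq_fun do rewrite ReM; apply: bmB; exact: bmM.
by under eq_fun do rewrite ImM; apply: bmD; exact: bmM.
Qed.

Lemma cbmJ F : cbounded_meas F -> cbounded_meas (fun z => (F z)^*).
Proof.
move=> [F1 F2]; split; first by under eq_fun do rewrite ReJ.
by under eq_fun do rewrite ImJ; exact: bmN.
Qed.

Lemma cbmX F n : cbounded_meas F -> cbounded_meas (fun z => F z ^+ n).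
Proof.
move=> bF; elim: n => [|n IHn].
  by under eq_fun do rewrite expr0; exact: cbm_cst.
by under eq_fun do rewrite exprS; exact: cbmM.
Qed.

Lemma cbm_horner (p : {poly R[i]}) : cbounded_meas (fun z => p.[circle_val z]).
Proof.
elim/poly_ind: p => [|p c IHp].
  by under eq_fun do rewrite horner0; exact: cbm_cst.
under eq_fun do rewrite hornerMXaddC.
by apply: cbmD; [apply: cbmM => //; exact: cbm_val|exact: cbm_cst].
Qed.

(** * The resolvent and the Poisson kernel *)

Definition resolvent (r : R) z : R[i] := (circle_val z - r%:C)^-1.

Lemma resolvent_neq0 r z : 0 < r < 1 -> circle_val z - r%:C != 0.
Proof.
move=> r01; apply/eqP => /eqP; rewrite subr_eq0 => /eqP zr.
by have := circle_val_ReIm z; rewrite zr /= => h; move: r01; nra.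
Qed.

(** This is |z - r| ^ 2 for z on the circle. *)
Let D r z := 1 + r ^+ 2 - 2 * r * complex.Re (circle_val z).

Let D_ge r z : 0 < r < 1 -> (1 - r) ^+ 2 <= D r z.
Proof.
move=> /andP[r0 r1]; rewrite /D; have := circle_val_ReIm z => h.
suff : complex.Re (circle_val z) <= 1 by nra.
by have := sqr_ge0 (complex.Im (circle_val z)); nra.
Qed.

Let D_gt0 r z : 0 < r < 1 -> 0 < D r z.
Proof.
by move=> r01; apply: lt_le_trans (D_ge r z r01); rewrite exprn_gt0//; lra.
Qed.

Let resolventE r z : 0 < r < 1 ->
  resolvent r z = (circle_val z - r%:C)^* * ((D r z)^-1)%:C.
Proof.
move=> r01; apply: (mulfI (resolvent_neq0 _ z r01)).
rewrite mulfV ?resolvent_neq0// mulrA.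
have -> : (circle_val z - r%:C) * (circle_val z - r%:C)^* = (D r z)%:C.
  have := circle_val_ReIm z; rewrite /D; case: (circle_val z) => a b /= h.
  apply/eqP; rewrite eq_complex /=; apply/andP; split; apply/eqP; last by ring.
  by transitivity (a ^+ 2 + b ^+ 2 + r ^+ 2 - 2 * r * a); [ring|rewrite h].
by rewrite -rmorphM mulfV ?rmorph1// gt_eqF ?D_gt0.
Qed.

Lemma resolvent_normE r z : 0 < r < 1 ->
  complex.Re (resolvent r z * (resolvent r z)^*) =
  (1 + r ^+ 2 - 2 * r * complex.Re (circle_val z))^-1.
Proof.
move=> r01; rewrite ReMJ resolventE//= -/(D r z); have D0 := D_gt0 _ z r01.
have := circle_val_ReIm z; have : D r z = D r z by []; rewrite {2}/D.
case: (circle_val z) => a b /= dE h.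
have -> : ((a - r) * (D r z)^-1 - - (b - 0) * 0) ^+ 2 +
   ((a - r) * 0 + - (b - 0) * (D r z)^-1) ^+ 2 =
   ((a ^+ 2 + b ^+ 2) + r ^+ 2 - 2 * r * a) / (D r z) ^+ 2.
  by field; rewrite gt_eqF.
by rewrite h -dE; field; rewrite gt_eqF.
Qed.

(** The Poisson kernel (1 - r ^ 2) / |z - r| ^ 2 is the real part of (z + r) / (z - r) = 1 + 2 r /
    (z - r). *)
Lemma resolvent_poisson r z : 0 < r < 1 ->
  (1 - r ^+ 2) * complex.Re (resolvent r z * (resolvent r z)^*) =
  1 + 2 * r * complex.Re (resolvent r z).
Proof.
move=> r01; rewrite resolvent_normE// resolventE//= -/(D r z).
have D0 := D_gt0 _ z r01; have : D r z = D r z by []; rewrite {2}/D.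
case: (circle_val z) => a b /= dE.
apply: (mulIf (lt0r_neq0 D0)); rewrite [RHS]mulrDl.
have -> : 2 * r * ((a - r) / D r z - - (b - 0) * 0) * D r z = 2 * r * (a - r).
  by field; rewrite gt_eqF.
have -> : (1 - r ^+ 2) * (D r z)^-1 * D r z = 1 - r ^+ 2 by field; rewrite gt_eqF.
by rewrite dE; ring.
Qed.

Lemma circle_val_resolvent r z : 0 < r < 1 ->
  circle_val z * resolvent r z = 1 + r%:C * resolvent r z.
Proof.
move=> r01; apply: (mulIf (resolvent_neq0 _ z r01)).
rewrite -mulrA mulVf ?resolvent_neq0// mulr1 mulrDl mul1r.
by rewrite -mulrA mulVf ?resolvent_neq0// mulr1 subrK.
Qed.

Lemma cbm_resolvent r : 0 < r < 1 -> cbounded_meas (resolvent r).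
Proof.
move=> r01; have -> : resolvent r =
    (fun z => (circle_val z - r%:C)^* * ((D r z)^-1)%:C).
  by apply/funext => z; rewrite resolventE.
apply: cbmM; first by apply/cbmJ/cbmD; [exact: cbm_val|exact: cbm_cst].
split => /=; last exact: bm_cst.
apply: (bmV _ ((1 - r) ^+ 2)); first by rewrite exprn_gt0//; lra.
  by move=> z; exact: D_ge.
by apply: bmB; [exact: bm_cst|apply: bmM; [exact: bm_cst|exact: bm_Re]].
Qed.

End bounded_measurable.

(** * Integration against a probability measure, and Bessel's inequality *)

Section integral.
Context {R : realType} (mu : probability (circle R) R).
Implicit Types (f g : circle R -> R) (F G : circle R -> R[i]) (z : circle R).

Lemma bm_integrable f : bounded_meas f -> mu.-integrable [set: circle R] (EFin \o f).
Proof.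
move=> [mf [M fM]]; apply: measurable_bounded_integrable => //.
  exact: (le_lt_trans (probability_le1 mu measurableT) (ltry 1)).
by exists M; split; [exact: num_real|move=> K MK z _; exact: le_trans (fM z) (ltW MK)].
Qed.

Lemma intD f g : bounded_meas f -> bounded_meas g ->
  \int[mu]_z (f z + g z) = \int[mu]_z f z + \int[mu]_z g z.
Proof. by move=> bf bg; apply: RintegralD => //; exact: bm_integrable. Qed.

Lemma intZ (a : R) f : bounded_meas f ->
  \int[mu]_z (a * f z) = a * \int[mu]_z f z.
Proof. by move=> bf; apply: RintegralZl => //; exact: bm_integrable. Qed.

Lemma int_cst (a : R) : \int[mu]_z (fun=> a) z = a.
Proof.
rewrite /= Rintegral_cst// (_ : fine _ = 1) ?mulr1//.
by rewrite -[RHS]/(fine 1%E); congr fine; exact: probability_setT.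
Qed.

(** The real part of the Hermitian product of L^2(mu), a symmetric real-bilinear form; it suffices
    because the recurrence coefficients are real. *)
Definition ip F G := \int[mu]_z complex.Re (F z * (G z)^*).

Lemma ip_ge0 F : 0 <= ip F F.
Proof. by apply: Rintegral_ge0 => z _; exact: ReMJ_ge0. Qed.

Lemma ipC F G : ip F G = ip G F.
Proof.
apply: eq_Rintegral => z _; rewrite -ReJ rmorphM /= mulrC; congr (complex.Re (_ * _)).
exact: conjCK.
Qed.

Lemma bm_ip F G : cbounded_meas F -> cbounded_meas G ->
  bounded_meas (fun z => complex.Re (F z * (G z)^*)).
Proof. by move=> bF bG; have [] := cbmM _ _ bF (cbmJ _ bG). Qed.

Lemma ipDl F1 F2 G : cbounded_meas F1 -> cbounded_meas F2 -> cbounded_meas G ->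
  ip (fun z => F1 z + F2 z) G = ip F1 G + ip F2 G.
Proof.
move=> b1 b2 bG; rewrite /ip -intD; try exact: bm_ip.
by apply: eq_Rintegral => z _; rewrite mulrDl ReD.
Qed.

Lemma ipZl (a : R) F G : cbounded_meas F -> cbounded_meas G ->
  ip (fun z => a%:C * F z) G = a * ip F G.
Proof.
move=> bF bG; rewrite /ip -intZ; last exact: bm_ip.
by apply: eq_Rintegral => z _; rewrite -mulrA ReM /= mul0r subr0.
Qed.

Lemma ipDr F1 F2 G : cbounded_meas F1 -> cbounded_meas F2 -> cbounded_meas G ->
  ip G (fun z => F1 z + F2 z) = ip G F1 + ip G F2.
Proof. by move=> *; rewrite ipC ipDl// ![ip _ G]ipC. Qed.

Lemma ipZr (a : R) F G : cbounded_meas F -> cbounded_meas G ->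
  ip G (fun z => a%:C * F z) = a * ip G F.
Proof. by move=> *; rewrite ipC ipZl// ipC. Qed.

Lemma ip_norm_le F G : cbounded_meas F -> cbounded_meas G ->
  2 * `|ip F G| <= ip F F + ip G G.
Proof.
move=> bF bG; have e (a : R) : ip (fun z => F z + a%:C * G z) (fun z => F z + a%:C * G z)
   = ip F F + 2 * a * ip F G + a ^+ 2 * ip G G.
  have baG : cbounded_meas (fun z => a%:C * G z) by apply: cbmM => //; exact: cbm_cst.
  rewrite ipDl ?ipDr ?ipZl ?ipZr//; try exact: cbmD.
  by rewrite (ipC G F); ring.
have := ip_ge0 (fun z => F z + (1 : R)%:C * G z).
have := ip_ge0 (fun z => F z + (- 1 : R)%:C * G z).
by rewrite !e; case: (ger0P (ip F G)) => ? ? ?; lra.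
Qed.

Lemma cbm_sum (s : seq nat) (c : nat -> R) (u : nat -> circle R -> R[i]) :
  (forall k, cbounded_meas (u k)) ->
  cbounded_meas (fun z => \sum_(k <- s) (c k)%:C * u k z).
Proof.
move=> bu; elim: s => [|k s IHs].
  by under eq_fun do rewrite big_nil; exact: cbm_cst.
under eq_fun do rewrite big_cons.
by apply: cbmD => //; apply: cbmM => //; exact: cbm_cst.
Qed.

Lemma ip_suml (s : seq nat) (c : nat -> R) (u : nat -> circle R -> R[i]) G :
  (forall k, cbounded_meas (u k)) -> cbounded_meas G ->
  ip (fun z => \sum_(k <- s) (c k)%:C * u k z) G = \sum_(k <- s) c k * ip (u k) G.
Proof.
move=> bu bG; elim: s => [|k s IHs].
  rewrite big_nil /ip -[RHS](int_cst 0); apply: eq_Rintegral => z _.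
  by rewrite big_nil mul0r.
rewrite big_cons -IHs -ipZl// -ipDl//; first last.
- exact: cbm_sum.
- by apply: cbmM => //; exact: cbm_cst.
by apply: eq_Rintegral => z _; rewrite big_cons.
Qed.

(** The difference of G and its orthogonal projection, here [G z + S z], has a nonnegative squared
    norm. *)
Lemma bessel (s : seq nat) (u : nat -> circle R -> R[i]) (nu : nat -> R) G :
  uniq s -> (forall k, cbounded_meas (u k)) -> cbounded_meas G ->
  (forall k, 0 < nu k) ->
  (forall j k, ip (u j) (u k) = nu k *+ (j == k)) ->
  \sum_(k <- s) ip G (u k) ^+ 2 / nu k <= ip G G.
Proof.
move=> us bu bG nu0 uu.
pose c k := - (ip (u k) G / nu k).
pose S z := \sum_(k <- s) (c k)%:C * u k z.
have bS : cbounded_meas S by exact: cbm_sum.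
have SG : ip S G = - \sum_(k <- s) ip G (u k) ^+ 2 / nu k.
  rewrite ip_suml// -sumrN; apply: eq_bigr => k _.
  by rewrite /c ipC; ring.
have SS : ip S S = \sum_(k <- s) ip G (u k) ^+ 2 / nu k.
  rewrite {1}/S ip_suml//; apply: eq_big_seq => k ks.
  rewrite ipC ip_suml// (bigD1_seq k)//= big1_seq => [|j /andP[jk _]].
    by rewrite uu eqxx addr0 mulr1n /c (ipC G); field; rewrite gt_eqF.
  by rewrite uu (negbTE jk) mulr0n mulr0.
have := ip_ge0 (fun z => G z + S z).
rewrite ipDl ?ipDr//; try exact: cbmD.
by rewrite (ipC G S) SS SG; lra.
Qed.

End integral.

(** * Lebesgue measure and the Steklov condition *)

Section lebesgue.
Context {R : realType}.
Implicit Types (f g : circle R -> R) (F G : circle R -> R[i]) (z : circle R).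
Local Notation leb := (circle_lebesgue R).

Lemma int_lebesgue f : bounded_meas f ->
  \int[leb]_z f z = \int[@lebesgue_measure R]_(t in `[0, 1]) f (expi t).
Proof.
move=> bf; have [mf _] := bf.
rewrite /Rintegral; congr fine.
pose g t := f (expi t).
have mg : measurable_fun [set: measurableTypeR R] g.
  exact: (measurableT_comp mf (@measurable_expi R)).
have m01 : measurable (`[0%R, 1%R[%classic : set (measurableTypeR R)).
  exact: measurable_itv.
have ig : (unif01 R).-integrable [set: measurableTypeR R] (EFin \o g).
  apply: measurable_bounded_integrable => //.
    apply: (@le_lt_trans _ _ 1%E); last exact: ltry.
    rewrite /unif01 /= /mrestr setTI.
    by rewrite lebesgue_measure_itv /= lte_fin ltr01 oppr0 adde0.
  have [_ [M fM]] := bf.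
  by exists M; split; [exact: num_real|move=> K MK t _; exact: le_trans (fM _) (ltW MK)].
transitivity (\int[unif01 R]_(t in [set: measurableTypeR R]) (EFin \o g) t)%E.
  rewrite -(preimage_setT (@expi R)).
  transitivity (\int[pushforward (unif01 R) (@expi R)]_(z in [set: circle R]) (EFin \o f) z)%E.
    apply: eq_measure_integral; first exact: measurable_expi.
    by move=> mexpi A mA _.
  refine (@integral_pushforward _ _ (measurableTypeR R) (circle R) R
    (@expi R) (@measurable_expi R) (unif01 R)
    [set: circle R] (EFin \o f) _ _ measurableT).
    exact/measurable_EFinP.
  rewrite preimage_setT; exact: ig.
transitivity (\int[unif01 R]_(t in [set: measurableTypeR R] `\`
    ~` `[0%R, 1%R[%classic) (EFin \o g) t)%E.
  apply: negligible_integral => //; first exact: measurableC.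
  by rewrite /unif01 /= /mrestr setICl measure0.
rewrite setTD setCK -integral_itv_bndo_bndc; last first.
  apply/measurable_EFinP; apply: (measurable_funS (E := [set: measurableTypeR R])) => //.
apply: eq_measure_integral => A mA A01.
by rewrite /unif01 /= /mrestr; congr lebesgue_measure; exact/setIidl.
Qed.

Lemma expi_pow (t : R) k : circle_val (expi t) ^+ k =
  cos (2 * pi * k%:R * t) +i* sin (2 * pi * k%:R * t).
Proof.
elim: k => [|k IHk]; first by rewrite expr0 mulr0 mul0r cos0 sin0.
rewrite exprS IHk.
have -> : 2 * pi * k.+1%:R * t = 2 * pi * t + 2 * pi * k%:R * t.
  by rewrite -[k.+1%:R]natr1; ring.
by rewrite cosD sinD; apply/eqP; rewrite eq_complex /=; apply/andP; split; apply/eqP; ring.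
Qed.

Lemma int_lebesgue_pow (a : R[i]) k : (0 < k)%N ->
  \int[leb]_z complex.Re (a * circle_val z ^+ k) = 0.
Proof.
move=> k0; rewrite int_lebesgue; last first.
  by have [] := cbmM _ _ (cbm_cst a) (cbmX _ k cbm_val).
pose w : R := 2 * pi * k%:R.
pose G (t : R) := complex.Re a * cos (w * t) - complex.Im a * sin (w * t).
(* An antiderivative of G; it takes equal values at 0 and 1 since w is a multiple of 2 pi. *)
pose F (t : R) := complex.Re a / w * sin (w * t) + complex.Im a / w * cos (w * t).
have w0 : w != 0 by rewrite gt_eqF// !mulr_gt0 ?pi_gt0// ltr0n.
have dF (t : R) : is_derive t (1 : R) F (G t).
  rewrite /F; apply: is_derive_eq.
  rewrite /G /GRing.scale /=; field.
  exact: w0.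
have cG : continuous G.
  move=> t; apply: differentiable_continuous; apply/derivable1_diffP.
  by rewrite /G; exact: ex_derive.
have cF : continuous F.
  move=> t; apply: differentiable_continuous; apply/derivable1_diffP.
  exact: ex_derive.
have [cw sw] : cos w = 1 /\ sin w = 0.
  have := expi_pow 1 k; rewrite mulr1 -/w.
  have -> : circle_val (expi (1 : R)) = 1.
    by rewrite /circle_val /= mulr1 mulr_natl cos2pi sin2pi.
  by rewrite expr1n => -[].
transitivity (\int[@lebesgue_measure R]_(t in `[0, 1]) G t).
  by apply: eq_Rintegral => t _; rewrite expi_pow ReM.
rewrite /Rintegral (continuous_FTC2 (F := F)) ?ltr01//.
- by rewrite /= /F mulr1 mulr0 cw sw cos0 sin0 subrr.
- exact: continuous_subspaceT.
- split.
  + by move=> t _; exact: ex_derive.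
  + exact: cvg_at_right_filter (cF _).
  + exact: cvg_at_left_filter (cF _).
- by move=> t _; rewrite derive1E; exact: derive_val.
Qed.

Lemma int_lebesgue_pow_conj (a : R[i]) k : (0 < k)%N ->
  \int[leb]_z complex.Re (a * (circle_val z)^* ^+ k) = 0.
Proof.
move=> k0; rewrite -[RHS](int_lebesgue_pow a^* k k0); apply: eq_Rintegral => z _.
by rewrite -ReJ rmorphM rmorphXn /= conjCK.
Qed.

(** Parseval's identity, by induction on p X + c: multiplication by z is isometric, and z p(z) is
    orthogonal to constants. *)
Lemma ip_lebesgue_horner (p : {poly R[i]}) :
  ip leb (fun z => p.[circle_val z]) (fun z => p.[circle_val z]) =
  \sum_(j < size p) complex.Re (p`_j * (p`_j)^*).
Proof.
elim/poly_ind: p => [|p c IHp].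
  rewrite size_poly0 big_ord0 -[RHS](int_cst leb 0).
  by apply: eq_Rintegral => z _; rewrite horner0 mul0r.
have -> : ip leb (fun z => (p * 'X + c%:P).[circle_val z])
    (fun z => (p * 'X + c%:P).[circle_val z]) =
    ip leb (fun z => p.[circle_val z]) (fun z => p.[circle_val z]) +
    complex.Re (c * c^*).
  have bp := cbm_horner p; have bz := @cbm_val R.
  have bzp : cbounded_meas (fun z => p.[circle_val z] * circle_val z) by exact: cbmM.
  have -> : complex.Re (c * c^*) = ip leb (fun=> c) (fun=> c) by rewrite /ip (int_cst leb).
  have -> : ip leb (fun z => p.[circle_val z]) (fun z => p.[circle_val z]) =
      ip leb (fun z => p.[circle_val z] * circle_val z)
             (fun z => p.[circle_val z] * circle_val z).
    apply: eq_Rintegral => z _; rewrite rmorphM /= mulrACA circle_valJ mulr1.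
    by [].
  have cross : ip leb (fun z => p.[circle_val z] * circle_val z) (fun=> c) = 0.
    (* Stated for every positive power of z, since peeling the constant term of q raises the power
       by one. *)
    have suf q k : (0 < k)%N ->
        ip leb (fun z => q.[circle_val z] * circle_val z ^+ k) (fun=> c) = 0.
      elim/poly_ind: q k => [|q b IHq] k k0.
        rewrite -[RHS](int_cst leb 0).
        by apply: eq_Rintegral => z _; rewrite horner0 !mul0r.
      rewrite -[RHS]addr0 -{2}(int_lebesgue_pow (b * c^*) k k0) -(IHq k.+1)//.
      rewrite /ip -intD; first last.
      - by have [] := cbmM _ _ (cbm_cst (b * c^*)) (cbmX _ k bz).
      - by apply: bm_ip; [apply: cbmM; [exact: cbm_horner|exact: cbmX]|exact: cbm_cst].
      apply: eq_Rintegral => z _; rewrite -ReD; congr complex.Re.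
      by rewrite hornerMXaddC exprS; ring.
    by have := suf p 1%N isT; apply: etrans; apply: eq_Rintegral => z _; rewrite expr1.
  transitivity (ip leb (fun z => p.[circle_val z] * circle_val z + c)
     (fun z => p.[circle_val z] * circle_val z + c)).
    by apply: eq_Rintegral => z _; rewrite hornerMXaddC.
  rewrite ipDl ?ipDr ?(ipC leb (fun=> c) (fun z => p.[circle_val z] * circle_val z)) ?cross;
    try exact: cbm_cst; try by []; try by (apply: cbmD => //; exact: cbm_cst).
  by rewrite addr0 add0r.
rewrite IHp.
have coefE j : (p * 'X + c%:P)`_j = if j is j'.+1 then p`_j' else c.
  by rewrite coefD coefMX coefC; case: j => [|j] /=; rewrite ?add0r ?addr0.
have norm0 : complex.Re (0 * 0^* : R[i]) = 0 by rewrite mul0r.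
have szE (q : {poly R[i]}) n : (size q <= n)%N ->
    \sum_(j < size q) complex.Re (q`_j * (q`_j)^*) =
    \sum_(j < n) complex.Re (q`_j * (q`_j)^*).
  move=> qn; rewrite (big_ord_widen _ (fun j => complex.Re (q`_j * (q`_j)^*)) qn).
  rewrite [RHS](bigID (fun j : 'I_n => (j < size q)%N)) /= [X in _ + X]big1 ?addr0//.
  by move=> j; rewrite -leqNgt => /(nth_default 0) ->.
have sz : (size (p * 'X + c%:P)%R <= (size p).+1)%N.
  by rewrite size_MXaddC; case: ifP.
rewrite (szE _ _ sz) big_ord_recl coefE addrC; congr (_ + _).
by apply: eq_bigr => j _; rewrite coefE.
Qed.

Lemma resolvent_unfold r z i : 0 < r < 1 ->
  (circle_val z)^* ^+ i * resolvent r z =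
  (circle_val z)^* ^+ i.+1 + r%:C * ((circle_val z)^* ^+ i.+1 * resolvent r z).
Proof.
move=> r01; have := circle_val_resolvent r z r01; have := circle_valJ z.
set w := circle_val z; set K := resolvent r z => wJ wK.
have e : K = w^* + r%:C * (w^* * K).
  rewrite -[LHS]mul1r -wJ (mulrC w) -mulrA wK; ring.
by rewrite [in LHS]e exprS; ring.
Qed.

Lemma geometric_vanish (a C r : R) : 0 < r < 1 ->
  (forall k, `|a| <= C * r ^+ k) -> a = 0.
Proof.
move=> /andP[r0 r1] h.
have c0 : (fun k => C * r ^+ k) @ \oo --> C * 0.
  by apply: cvgMl_tmp; apply: cvg_expr; rewrite gtr0_norm.
apply/eqP; rewrite -normr_le0 -(mulr0 C); apply: (cvgr_to_ge c0).
exact: nearW.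
Qed.

(** Expanding the resolvent i times in powers of conj z, all of which integrate to 0, leaves r ^ i
    times an integral bounded uniformly in i. *)
Lemma int_lebesgue_resolvent r : 0 < r < 1 ->
  \int[leb]_z complex.Re (resolvent r z) = 0.
Proof.
move=> r01; have bK := cbm_resolvent r r01; have bz := cbmJ _ (@cbm_val R).
have E i : \int[leb]_z complex.Re (resolvent r z) =
    r ^+ i * \int[leb]_z complex.Re ((circle_val z)^* ^+ i * resolvent r z).
  elim: i => [|i ->].
    by rewrite mul1r; apply: eq_Rintegral => z _; rewrite expr0 mul1r.
  have bi k : cbounded_meas (fun z => (circle_val z)^* ^+ k) by exact: cbmX.
  have biK : cbounded_meas (fun z => (circle_val z)^* ^+ i.+1 * resolvent r z).
    exact: cbmM.
  rewrite exprSr -mulrA; congr (_ * _); rewrite -intZ; last by case: biK.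
  rewrite -[RHS]add0r -{1}(int_lebesgue_pow_conj 1 i.+1 isT) -intD.
  - apply: eq_Rintegral => z _; rewrite resolvent_unfold// ReD mul1r.
    by rewrite [X in _ + X]ReM /= mul0r subr0.
  - by have [] := cbmM _ _ (cbm_cst 1) (bi i.+1).
  - by apply: bmM; [exact: bm_cst|case: biK].
pose M := 1 + ip leb (resolvent r) (resolvent r).
have M0 k : `|ip leb (resolvent r) (fun z => circle_val z ^+ k)| <= M.
  have bk := cbmX _ k (@cbm_val R); have := ip_norm_le leb _ _ bK bk.
  have -> : ip leb (fun z => circle_val z ^+ k) (fun z => circle_val z ^+ k) = 1.
    rewrite -[RHS](int_cst leb 1); apply: eq_Rintegral => z _.
    by rewrite rmorphXn /= -exprMn circle_valJ expr1n.
  have p0 := ip_ge0 leb (resolvent r); rewrite /M.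
  move: (`|_|) (ip _ _ _) p0 => q p p0 h; clear -p0 h; lra.
apply: (@geometric_vanish _ M r) => // k.
rewrite (E k) mulrC normrM (ger0_norm (exprn_ge0 _ _)); last by lra.
apply: ler_wpM2r; first by rewrite exprn_ge0//; lra.
apply: le_trans (M0 k); rewrite le_eqVlt; apply/orP; left; apply/eqP.
by congr `|_|; apply: eq_Rintegral => z _; rewrite mulrC rmorphXn.
Qed.

(** The inequality mu >= c m, tested on functions; all later estimates use the Steklov condition in
    this form. *)
Definition minorized (mu : probability (circle R) R) (c : R) :=
  forall f, bounded_meas f -> (forall z, 0 <= f z) ->
    c * \int[leb]_z f z <= \int[mu]_z f z.

(** Take c at most the essential infimum of w and drop the singular part, which is nonnegative. *)
Lemma steklov_minorized (mu : probability (circle R) R) :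
  steklov mu -> exists2 c : R, 0 < c & minorized mu c.
Proof.
move=> [w [mus [[mw w0 _ muE] ei]]].
have [c c0 cw] : exists2 c : R, 0 < c &
    \forall z \ae leb, (c%:E <= (w z)%:E)%E.
  have [y y0 yw] : exists2 y : R, 0 < y & (y%:E <= ess_inf leb (EFin \o w))%E.
    case: (ess_inf _ _) ei => [y| |] //; first by rewrite lte_fin; exists y.
    (* If the essential infimum is infinite, any positive constant will do. *)
    by exists 1 => //; exact: leey.
  by exists y => //; exact/ess_infP.
exists c => // f bf f0; have [mf _] := bf.
have cmu A : measurable A -> (mscale (NngNum (ltW c0)) leb A <= mu A)%E.
  move=> mA; rewrite muE// /mscale /=.
  apply: (@le_trans _ _ (\int[leb]_(z in A) (w z)%:E)%E); last by rewrite leeDl.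
  rewrite -integral_cst//; apply: ae_ge0_le_integral => //.
  - by move=> z _; rewrite lee_fin ltW.
  - by move=> z _; rewrite lee_fin.
  - by apply/measurable_EFinP; exact: measurable_funS mw.
  - by apply: filterS cw => z.
have fl := bm_integrable leb _ bf; have fm := bm_integrable mu _ bf.
have mEf : measurable_fun [set: circle R] (EFin \o f) by exact/measurable_EFinP.
have Ef0 z : (0 <= (EFin \o f) z)%E by rewrite lee_fin.
have := ge0_le_measure_integral cmu measurableT Ef0 mEf.
rewrite ge0_integral_mscale//=; last by move=> z _; exact: Ef0.
move=> h.
have f1 := integrable_fin_num measurableT fl.
have f2 := integrable_fin_num measurableT fm.
by rewrite -lee_fin /Rintegral EFinM !fineK.
Qed.
End lebesgue.

(** * Orthogonal polynomials *)

Fixpoint szego {S : comNzRingType} (a : nat -> S) (t : S) (k : nat) : S * S :=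
  if k is j.+1 then
    let: (f, g) := szego a t j in (t * f - a j * g, g - a j * (t * f))
  else (1, 1).

Lemma szegoS {S : comNzRingType} (a : nat -> S) (t : S) k :
  szego a t k.+1 =
  (t * (szego a t k).1 - a k * (szego a t k).2,
   (szego a t k).2 - a k * (t * (szego a t k).1)).
Proof. by rewrite /=; case: szego. Qed.

(** The reversal Phi_k^*(t) = t ^ k Phi_k(1 / t) for real coefficients; it turns estimates of Phi_k
    at 1 / r into estimates of Phi_k^* at r. *)
Lemma szego_inv {S : fieldType} (a : nat -> S) (t : S) k : t != 0 ->
  (szego a t k).1 = t ^+ k * (szego a t^-1 k).2 /\
  (szego a t k).2 = t ^+ k * (szego a t^-1 k).1.
Proof.
move=> t0; elim: k => [|k [IH1 IH2]]; first by rewrite /= mulr1.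
by rewrite !szegoS /= IH1 IH2 !exprS; split; field.
Qed.

Section szego_polynomials.
Context {R : realType} (a : nat -> R).

Definition szego_poly k : {poly R[i]} * {poly R[i]} :=
  szego (fun j => (a j)%:C%:P) 'X k.
Definition sf k := (szego_poly k).1.
Definition sg k := (szego_poly k).2.

Lemma sf0 : sf 0 = 1. Proof. by []. Qed.
Lemma sg0 : sg 0 = 1. Proof. by []. Qed.

Lemma sfS k : sf k.+1 = 'X * sf k - (a k)%:C%:P * sg k.
Proof. by rewrite /sf /szego_poly szegoS. Qed.

Lemma sgS k : sg k.+1 = sg k - (a k)%:C%:P * ('X * sf k).
Proof. by rewrite /sg /szego_poly szegoS. Qed.

Lemma szego_real (t : R) k : (sf k).[t%:C] = ((szego a t k).1)%:C /\
  (sg k).[t%:C] = ((szego a t k).2)%:C.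
Proof.
elim: k => [|k [IH1 IH2]]; first by rewrite sf0 sg0 hornerC.
by rewrite sfS sgS szegoS !hornerE IH1 IH2 /= !rmorphB !rmorphM.
Qed.

Lemma szego_circle (z : circle R) k :
  (sg k).[circle_val z] = circle_val z ^+ k * ((sf k).[circle_val z])^*.
Proof.
have zJ := circle_valJ z.
(* The reversal relation and its mirror image are proved together, as the recursion couples them. *)
suff [] : (sg k).[circle_val z] = circle_val z ^+ k * ((sf k).[circle_val z])^* /\
  (sf k).[circle_val z] = circle_val z ^+ k * ((sg k).[circle_val z])^* by [].
elim: k => [|k [IH1 IH2]].
  by rewrite sf0 sg0 hornerC rmorph1 mulr1.
have aJ : ((a k)%:C)^* = (a k)%:C :> R[i] by exact: conjc_real.
rewrite sfS sgS !hornerE !rmorphB !rmorphM /= aJ.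
move: (circle_val z) zJ IH1 IH2 => w wJ IH1 IH2.
have e1 : w ^+ k.+1 * (w^* * ((sf k).[w])^*) = (sg k).[w].
  by rewrite IH1 -[RHS]mul1r -wJ exprS; ring.
have e2 : w ^+ k.+1 * ((sg k).[w])^* = w * (sf k).[w].
  by rewrite [X in w * X]IH2 exprS; ring.
split; rewrite mulrBr; first by rewrite e1 [in RHS]mulrCA e2 mulrA.
by rewrite e2 -[_ * w^* * _]mulrA [in RHS]mulrCA e1.
Qed.

Lemma size_szego k : size (sf k) = k.+1 /\ (size (sg k) <= k.+1)%N.
Proof.
elim: k => [|k [IH1 IH2]]; first by rewrite sf0 sg0 size_poly1.
have sX : size ('X * sf k) = k.+2.
  by rewrite mulrC size_mulX ?IH1// -size_poly_gt0 IH1.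
have sC (p : {poly R[i]}) : (size ((a k)%:C%:P * p)%R <= size p)%N.
  by rewrite mul_polyC size_scale_leq.
rewrite sfS sgS; split.
  rewrite size_polyDl ?sX// size_polyN ltnS (leq_trans (sC _))//.
rewrite (leq_trans (size_polyD _ _))// geq_max (leq_trans IH2)//=.
by rewrite size_polyN (leq_trans (sC _))// sX.
Qed.

Lemma monic_sf k : sf k \is monic.
Proof.
elim: k => [|k IHk]; first by rewrite sf0 monic1.
rewrite monicE sfS lead_coefDl.
  by rewrite mulrC lead_coefMX -monicE.
have [s1 s2] := size_szego k.
have -> : size ('X * sf k) = k.+2 by rewrite mulrC size_mulX ?s1// -size_poly_gt0 s1.
by rewrite size_polyN mul_polyC ltnS (leq_trans (size_scale_leq _ _)).
Qed.

Lemma szego_horner0 k : (sg k).[0] = 1 /\ (sf k.+1).[0] = - (a k)%:C.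
Proof.
have g1 j : (sg j).[0] = 1.
  elim: j => [|j IHj]; first by rewrite sg0 hornerC.
  by rewrite sgS !hornerE IHj /=; ring.
by split=> //; rewrite sfS !hornerE g1 /=; ring.
Qed.

(** Since p ranges over complex polynomials, replacing p by i p shows that vanishing of the real
    part is full orthogonality. *)
Definition szego_orthogonal (mu : probability (circle R) R) :=
  forall (p : {poly R[i]}) k, (size p <= k)%N ->
    ip mu (fun z => p.[circle_val z]) (fun z => (sf k).[circle_val z]) = 0.

End szego_polynomials.

(** * Orthogonality for a minorized measure *)

Section orthogonality.
Context {R : realType} (mu : probability (circle R) R) (c : R).
Hypotheses (c_gt0 : 0 < c) (mu_c : minorized mu c).
Implicit Types p q : {poly R[i]}.

Local Notation ev p := (fun z => p.[circle_val z]).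

Lemma ip_horner_ge p :
  c * \sum_(j < size p) complex.Re (p`_j * (p`_j)^*) <= ip mu (ev p) (ev p).
Proof.
rewrite -ip_lebesgue_horner; apply: mu_c.
  by apply: bm_ip; exact: cbm_horner.
by move=> z; exact: ReMJ_ge0.
Qed.

Lemma ip_horner_ge_coef p n : (size p <= n)%N ->
  c * \sum_(j < n) complex.Re p`_j ^+ 2 <= ip mu (ev p) (ev p).
Proof.
move=> pn; apply: le_trans (ip_horner_ge p); rewrite ler_pM2l//.
rewrite (bigID (fun j : 'I_n => (j < size p)%N)) /= [X in _ + X]big1 ?addr0.
  rewrite -(big_ord_widen _ (fun j => complex.Re p`_j ^+ 2) pn).
  by apply: ler_sum => j _; rewrite ReMJ lerDl sqr_ge0.
by move=> j; rewrite -leqNgt => /(nth_default 0) ->; rewrite expr0n.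
Qed.

Lemma ip_horner_eq0 p : ip mu (ev p) (ev p) <= 0 -> p = 0.
Proof.
move=> p0; apply/polyP => j; rewrite coef0.
have [pj|jp] := leqP (size p) j; first by rewrite nth_default.
have : complex.Re (p`_j * (p`_j)^*) <= 0.
  have := le_trans (ip_horner_ge p) p0; rewrite pmulr_rle0//.
  rewrite (bigD1 (Ordinal jp))//=; apply: le_trans; rewrite lerDl sumr_ge0// => i _.
  exact: ReMJ_ge0.
rewrite ReMJ; case: (p`_j) => x y /= h; apply/eqP; rewrite eq_complex /=.
have := sqr_ge0 x; have := sqr_ge0 y => hy hx.
have x0 : x ^+ 2 = 0 by lra.
have y0 : y ^+ 2 = 0 by lra.
by move/eqP: x0; move/eqP: y0; rewrite !sqrf_eq0 => /eqP-> /eqP->; rewrite !eqxx.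
Qed.

Section phi.
Variables (Phi : nat -> {poly R[i]}) (moP : monic_orthogonal mu Phi).

Lemma ip_scale_orthogonal (b : R[i]) j k : j != k ->
  ip mu (ev (b *: Phi j)) (ev (Phi k)) = 0.
Proof.
have [_ _ o] := moP => /o; rewrite /pinner /cintegral => -[re0 im0].
have bjk := cbmM _ _ (cbm_horner (Phi j)) (cbmJ _ (cbm_horner (Phi k))).
have [bre bim] := bjk.
transitivity (\int[mu]_z (complex.Re b *
    complex.Re ((Phi j).[circle_val z] * ((Phi k).[circle_val z])^*)
   + - complex.Im b * complex.Im ((Phi j).[circle_val z] * ((Phi k).[circle_val z])^*))).
  by apply: eq_Rintegral => z _; rewrite hornerZ -mulrA ReM mulNr.
rewrite intD; [|by apply: bmM => //; exact: bm_cst|by apply: bmM => //; exact: bm_cst].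
by rewrite !intZ// re0 im0 !mulr0 addr0.
Qed.

Lemma ip_orthogonal p k : (size p <= k)%N -> ip mu (ev p) (ev (Phi k)) = 0.
Proof.
have [mP sP _] := moP.
suff h m q : (m <= k)%N -> (size q <= m)%N -> ip mu (ev q) (ev (Phi k)) = 0.
  by move=> pk; exact: (h (size p)).
elim: m q => [|m IHm] q mk qm.
  move: qm; rewrite leqn0 size_poly_eq0 => /eqP ->.
  rewrite -[RHS](int_cst mu 0); apply: eq_Rintegral => z _.
  by rewrite horner0 mul0r.
pose q' := q - q`_m *: Phi m.
have sq' : (size q' <= m)%N.
  apply/leq_sizeP => j; rewrite leq_eqVlt => /predU1P[<-|mj].
    have := mP m; rewrite monicE /lead_coef sP /= => /eqP e.
    by rewrite coefB coefZ e mulr1 subrr.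
  rewrite coefB coefZ (nth_default _ (leq_trans qm mj)) (nth_default 0 (s := Phi m)) ?sP//.
  by rewrite mulr0 subr0.
have := IHm q' (ltnW mk) sq'.
have qE z : q.[circle_val z] = q'.[circle_val z] + (q`_m *: Phi m).[circle_val z].
  by rewrite -hornerD subrK.
move=> e; transitivity (ip mu
    (fun z => q'.[circle_val z] + (q`_m *: Phi m).[circle_val z]) (ev (Phi k))).
  by apply: eq_Rintegral => z _; rewrite qE.
rewrite ipDl ?e ?add0r; try exact: cbm_horner.
by apply: ip_scale_orthogonal; rewrite neq_ltn mk.
Qed.

Variable a : nat -> R.
Hypothesis aP : forall n, (a n)%:C = - ((Phi n.+1).[0])^*.

Lemma ip_mulX p q : ip mu (ev ('X * p)) (ev ('X * q)) = ip mu (ev p) (ev q).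
Proof.
apply: eq_Rintegral => z _; rewrite !hornerE rmorphM /= mulrACA.
by rewrite circle_valJ mul1r.
Qed.

Lemma ip_sg_sg k : ip mu (ev (sg a k)) (ev (sg a k)) = ip mu (ev (sf a k)) (ev (sf a k)).
Proof.
apply: eq_Rintegral => z _; rewrite szego_circle rmorphM rmorphXn /= mulrACA.
by rewrite -exprMn circle_valJ expr1n mul1r mulrC conjCK.
Qed.

(* On the circle, [Phi^* conj (z q)] equals [H conj Phi], where [H] reverses the
   conjugated coefficients of [q]. *)
Lemma ip_sg_mulX k q : Phi k = sf a k -> (size q <= k)%N ->
  ip mu (ev (sg a k)) (ev ('X * q)) = 0.
Proof.
move=> PE qk; pose H := \poly_(j < k) (q`_(k.-1 - j))^*.
rewrite -[RHS](ip_orthogonal H k (size_poly _ _)).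
apply: eq_Rintegral => z _; rewrite PE szego_circle !hornerE !rmorphM /=.
have zJ := circle_valJ z; move: (circle_val z) zJ => w wJ.
suff -> : H.[w] = (w^* ^+ k * (w * q.[w]))^*.
  by rewrite !rmorphM !rmorphXn /= conjCK; congr complex.Re; ring.
rewrite horner_poly (horner_coef_wide _ qk) !mulr_sumr rmorph_sum /=.
rewrite (reindex_inj rev_ord_inj) /=; apply: eq_bigr => i _.
have ki : (i < k)%N := ltn_ord i.
have -> : (k.-1 - (k - i.+1) = i)%N by lia.
set m := (k - i.+1)%N; set b := q`_i.
have -> : w^* ^+ k = w^* ^+ m * w^* ^+ i.+1.
  by rewrite -exprD; congr (_ ^+ _); rewrite /m; lia.
have wJi : w^* ^+ i.+1 * w ^+ i.+1 = 1 by rewrite -exprMn mulrC wJ expr1n.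
have -> : w^* ^+ m * w^* ^+ i.+1 * (w * (b * w ^+ i)) = w^* ^+ m * b.
  by rewrite -[RHS]mulr1 -wJi [w ^+ i.+1]exprS; ring.
by rewrite rmorphM rmorphXn /= conjCK mulrC.
Qed.

(** The difference D of the two monic polynomials of degree n + 1 has degree at most n and vanishes
    at 0, so D = X G with G of degree below n. It is then orthogonal to Phi_{n+1}, X Phi_n and
    Phi_n^*, hence to itself. *)
Lemma Phi_sf n : Phi n = sf a n.
Proof.
have [mP sP _] := moP.
elim: n => [|n IHn].
  have /size_poly1P[b b0 e] : size (Phi 0%N) == 1%N by rewrite sP.
  by have := mP 0%N; rewrite e sf0 monicE lead_coefC => /eqP ->.
apply/eqP; rewrite -subr_eq0; apply/eqP.
set D := _ - _.
have [s1 s2] := size_szego a n.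
have sX : size ('X * sf a n) = n.+2 by rewrite mulrC size_mulX ?s1// -size_poly_gt0 s1.
have sD : (size D <= n.+1)%N.
  apply/leq_sizeP => j; rewrite leq_eqVlt => /predU1P[<-|mj].
    have := mP n.+1; rewrite monicE /lead_coef sP /= => /eqP e.
    have := monic_sf a n.+1; rewrite monicE /lead_coef (size_szego a n.+1).1 /= => /eqP e'.
    by rewrite coefB e e' subrr.
  by rewrite coefB !nth_default ?subrr// ?sP// (size_szego a n.+1).1.
have D0 : D.[0] = 0.
  rewrite hornerD hornerN (szego_horner0 a n).2 opprK aP.
  have : ((a n)%:C)^* = (a n)%:C :> R[i] by exact: conjc_real.
  by rewrite aP rmorphN /= conjCK => /eqP; rewrite eqr_opp => /eqP <-; rewrite subrr.
have [G DE] : exists G, D = 'X * G.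
  have /factor_theorem[G e] : root D 0 by apply/eqP.
  by exists G; rewrite e subr0 mulrC.
have sG : (size G <= n)%N.
  have [->|G0] := eqVneq G 0; first by rewrite size_poly0.
  by move: sD; rewrite DE mulrC size_mulX.
apply: ip_horner_eq0; rewrite le_eqVlt; apply/orP; left; apply/eqP.
transitivity (ip mu (fun z => (Phi n.+1).[circle_val z] +
    ((- 1 : R)%:C * ('X * sf a n).[circle_val z] + (a n)%:C * (sg a n).[circle_val z])) (ev D)).
  apply: eq_Rintegral => z _; congr (complex.Re (_ * _)).
  by rewrite /D sfS !hornerE /= (rmorphN1 (real_complex R)); ring.
have bC (b : R) p : cbounded_meas (fun z => b%:C * p.[circle_val z]).
  by apply: cbmM; [exact: cbm_cst|exact: cbm_horner].
rewrite !ipDl ?ipZl; try exact: cbm_horner; try exact: bC; last by apply: cbmD; exact: bC.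
rewrite (ipC _ (ev (Phi n.+1))) (ip_orthogonal)// DE ip_mulX -IHn.
rewrite ipC (ip_orthogonal)// ip_sg_mulX//.
by rewrite !mulr0 !addr0.
Qed.

Lemma monic_orthogonal_szego : szego_orthogonal a mu.
Proof. by move=> p k; rewrite -Phi_sf; exact: ip_orthogonal. Qed.

End phi.

Section sf.
Variable a : nat -> R.
Hypothesis sfO : szego_orthogonal a mu.

(** The splitting z Phi_k = Phi_{k+1} + a_k Phi_k^* is orthogonal, and z Phi_k, Phi_k^* have the
    norm of Phi_k. *)
Lemma ip_sf_norm k : ip mu (ev (sf a k)) (ev (sf a k)) = szego_norm a k.
Proof.
elim: k => [|k IHk].
  rewrite /szego_norm big_ord0 -[RHS](int_cst mu 1); apply: eq_Rintegral => z _.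
  by rewrite sf0 hornerC rmorph1 mulr1.
rewrite szego_normS -IHk; have [s1 s2] := size_szego a k.
have e := ip_mulX (sf a k) (sf a k).
have bC (b : R) p : cbounded_meas (fun z => b%:C * p.[circle_val z]).
  by apply: cbmM; [exact: cbm_cst|exact: cbm_horner].
have fE : ip mu (ev ('X * sf a k)) (ev ('X * sf a k)) =
    ip mu (fun z => (sf a k.+1).[circle_val z] + (a k)%:C * (sg a k).[circle_val z])
          (fun z => (sf a k.+1).[circle_val z] + (a k)%:C * (sg a k).[circle_val z]).
  by apply: eq_Rintegral => z _; rewrite sfS !hornerE subrK.
move: e; rewrite fE ipDl ?ipDr ?ipZl ?ipZr//;
  try exact: cbm_horner; try exact: bC; last first.
  by apply: cbmD; [exact: cbm_horner|exact: bC].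
have gf : ip mu (ev (sg a k)) (ev (sf a k.+1)) = 0 by exact: sfO.
rewrite (ipC _ (ev (sf a k.+1)) (ev (sg a k))) gf ip_sg_sg => e.
by rewrite mulrBr mulr1 -[X in X - _]e; ring.
Qed.

(** Only the leading coefficient 1 is kept in the lower bound by the coefficients. *)
Lemma szego_norm_ge k : c <= szego_norm a k.
Proof.
have [s1 s2] := size_szego a k.
rewrite -ip_sf_norm; apply: le_trans (ip_horner_ge_coef (sf a k) k.+1 _); last by rewrite s1.
have := monic_sf a k; rewrite monicE /lead_coef s1 /= => /eqP e.
rewrite big_ord_recr/= e /= expr1n -[leLHS]mulr1 ler_wpM2l ?lerDr ?(ltW c_gt0)//.
by apply: sumr_ge0 => i _; exact: sqr_ge0.
Qed.

Lemma szego_norm_gt0 k : 0 < szego_norm a k.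
Proof. exact: lt_le_trans (szego_norm_ge k). Qed.

Lemma coef_lt1 k : `|a k| < 1.
Proof.
have := szego_norm_gt0 k.+1; rewrite szego_normS pmulr_rgt0 ?szego_norm_gt0//.
by rewrite subr_gt0 -[a k ^+ 2]real_normK ?num_real// expr_lt1.
Qed.

Lemma ip_sf j k : ip mu (ev (sf a j)) (ev (sf a k)) = szego_norm a k *+ (j == k).
Proof.
have [->|] := eqVneq; first by rewrite ip_sf_norm.
rewrite neq_ltn mulr0n => /orP[jk|kj]; first by rewrite sfO// (size_szego a j).1.
by rewrite ipC sfO// (size_szego a k).1.
Qed.

(* The polynomial [\sum_k f_k(t) / N_k f_k] takes at [t] the value of its own
   squared norm. *)
Lemma christoffel_le (t : R) n :
  \sum_(k < n) (szego a t k).1 ^+ 2 / szego_norm a k <= c^-1 * \sum_(j < n) (t ^+ j) ^+ 2.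
Proof.
set S := \sum_(k < n) _; set T := \sum_(j < n) _.
pose b k := (szego a t k).1 / szego_norm a k.
pose p : {poly R[i]} := \sum_(0 <= k < n) (b k)%:C *: sf a k.
have pE z : p.[circle_val z] = \sum_(0 <= k < n) (b k)%:C * (sf a k).[circle_val z].
  by rewrite horner_sum; apply: eq_bigr => k _; rewrite hornerZ.
have bp := cbm_horner p.
have bs k : cbounded_meas (fun z => (sf a k).[circle_val z]) := cbm_horner (sf a k).
have ipp : ip mu (ev p) (ev p) = S.
  transitivity (ip mu (fun z => \sum_(0 <= k < n) (b k)%:C * (sf a k).[circle_val z]) (ev p)).
    by apply: eq_Rintegral => z _; rewrite -pE.
  rewrite (ip_suml mu _ b (fun k => ev (sf a k)))//.
  rewrite /S -(big_mkord xpredT (fun k => (szego a t k).1 ^+ 2 / szego_norm a k)).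
  apply: eq_big_seq => k; rewrite mem_index_iota => /andP[_ kn]; rewrite ipC.
  transitivity (b k * ip mu
    (fun z => \sum_(0 <= j < n) (b j)%:C * (sf a j).[circle_val z]) (ev (sf a k))).
    by congr (_ * _); apply: eq_Rintegral => z _; rewrite -pE.
  rewrite (ip_suml mu _ b (fun k => ev (sf a k)))// (bigD1_seq k) ?iota_uniq ?mem_index_iota//=.
  rewrite big1 ?addr0 => [|j /negbTE jk]; last by rewrite ip_sf jk mulr0.
  by rewrite ip_sf eqxx mulr1n /b; field; rewrite gt_eqF ?szego_norm_gt0.
have pt : p.[t%:C] = S%:C.
  rewrite /S -(big_mkord xpredT (fun k => (szego a t k).1 ^+ 2 / szego_norm a k)).
  rewrite horner_sum rmorph_sum; apply: eq_bigr => k _.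
  by rewrite hornerZ (szego_real a t k).1 -rmorphM /=; congr (_%:C); rewrite /b; ring.
have sp : (size p <= n)%N.
  rewrite /p big_mkord; apply: (big_ind (fun q : {poly R[i]} => size q <= n)%N).
  - by rewrite size_poly0.
  - by move=> q q' sq sq'; rewrite (leq_trans (size_polyD _ _))// geq_max sq.
  - by move=> i _; rewrite (leq_trans (size_scale_leq _ _))// (size_szego a i).1.
have h := ip_horner_ge_coef p n sp; rewrite ipp in h.
have ptE : S = \sum_(j < n) complex.Re p`_j * t ^+ j.
  transitivity (complex.Re (p.[t%:C])); first by rewrite pt.
  rewrite (horner_coef_wide _ sp).
  rewrite (big_morph _ (@ReD R) (erefl : complex.Re 0 = 0)).
  by apply: eq_bigr => j _; rewrite -rmorphXn ReM /= mulr0 subr0.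
have c1 : 0 < c^-1 by rewrite invr_gt0.
(* Cauchy-Schwarz by completing the square: S = p(t) is paired with the bound c^-1 S on the sum of
   the squared coefficients. *)
have : 0 <= \sum_(j < n) (complex.Re p`_j - c^-1 * t ^+ j) ^+ 2.
  by apply: sumr_ge0 => j _; exact: sqr_ge0.
have -> : \sum_(j < n) (complex.Re p`_j - c^-1 * t ^+ j) ^+ 2 =
   \sum_(j < n) complex.Re p`_j ^+ 2 - 2 * c^-1 * S + c^-1 ^+ 2 * T.
  rewrite ptE !mulr_sumr -sumrB -big_split /=; apply: eq_bigr => j _; ring.
have hS : \sum_(j < n) complex.Re p`_j ^+ 2 <= c^-1 * S.
  by rewrite mulrC ler_pdivlMr// mulrC.
move=> h0; have : c^-1 * S <= c^-1 * (c^-1 * T) by rewrite mulrA -expr2; lra.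
by rewrite ler_pM2l.
Qed.

End sf.
End orthogonality.

(** * The Weyl solution *)

Section weyl.
Context {R : realType} (mu : probability (circle R) R) (c : R).
Hypotheses (c_gt0 : 0 < c) (mu_c : minorized mu c).
Variable a : nat -> R.
Local Notation ev p := (fun z => p.[circle_val z]).
Hypothesis sfO : szego_orthogonal a mu.
Variable r : R.
Hypothesis r01 : 0 < r < 1.

(** Conjugated so that [ip mu F (G i)] is the real part of the integral of F (conj z) ^ i / (z -
    r). *)
Let G i z := ((circle_val z)^* ^+ i * resolvent r z)^*.

Let bG i : cbounded_meas (G i).
Proof.
apply/cbmJ/cbmM; last exact: cbm_resolvent.
by apply/cbmX/cbmJ; exact: cbm_val.
Qed.

Let ip_G F i : cbounded_meas F ->
  ip mu F (G i) = ip mu F (fun z => circle_val z ^+ i.+1) + r * ip mu F (G i.+1).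
Proof.
move=> bF; rewrite -ipZr// -ipDr//; first last.
- by apply: cbmM => //; exact: cbm_cst.
- by apply: cbmX; exact: cbm_val.
apply: eq_Rintegral => z _; congr (complex.Re (_ * _)).
rewrite /G conjCK resolvent_unfold// rmorphD rmorphM rmorphXn /= conjCK.
by congr (_ + _ * _); exact/esym/conjc_real.
Qed.

Definition resolvent_norm := ip mu (resolvent r) (resolvent r).

Let ip_GG i : ip mu (G i) (G i) = resolvent_norm.
Proof.
apply: eq_Rintegral => z _; rewrite /G conjCK rmorphM rmorphXn /= conjCK mulrACA.
by rewrite -exprMn circle_valJ expr1n mul1r mulrC.
Qed.

(* Up to the factor [2 r], these are [F Phi_k + Psi_k] and [F Phi_k^* - Psi_k^*]
   for the Caratheodory function [F] and the second kind polynomials [Psi_k];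
   the term at [k = 0] makes the recursion hold from the start. *)
Definition weyl k := ip mu (ev (sf a k)) (G 0) + (k == 0)%:R / r.
Definition weyls k := ip mu (ev (sg a k)) (G 0).

Let ip_sf1 k : ip mu (ev (sf a k)) (fun=> 1) = (k == 0)%:R.
Proof.
have -> : ip mu (ev (sf a k)) (fun=> 1) = ip mu (ev (sf a 0)) (ev (sf a k)).
  by rewrite ipC; apply: eq_Rintegral => z _; rewrite sf0 hornerC.
by rewrite (ip_sf mu a sfO) eq_sym; case: k => [|k] /=; rewrite ?mulr0n// /szego_norm big_ord0.
Qed.

Lemma weyl_solution : szego_solution a r weyl weyls.
Proof.
have r0 : r != 0 by rewrite gt_eqF//; case/andP: r01.
move=> k; pose X := ip mu (ev ('X * sf a k)) (G 0).
(* By z / (z - r) = 1 + r / (z - r); the integral of Phi_k, nonzero only for k = 0, is matched by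
   the extra term of [weyl]. *)
have XE : X = r * weyl k.
  rewrite /weyl mulrDr mulrCA mulfV// mulr1 addrC -ip_sf1 -ipZr//; last exact: cbm_horner.
  have bG0 : cbounded_meas (fun z => r%:C * G 0 z) by apply: cbmM => //; exact: cbm_cst.
  rewrite -ipDr//; try exact: cbm_horner; try exact: cbm_cst.
  apply: eq_Rintegral => z _; rewrite !hornerE rmorphD rmorphM /=.
  have -> : (r%:C)^* = r%:C :> R[i] by exact: conjc_real.
  rewrite !conjCK /G !expr0 !mul1r rmorph1 -circle_val_resolvent//.
  by congr complex.Re; ring.
have bC (b : R) (p : {poly R[i]}) : cbounded_meas (fun z => b%:C * p.[circle_val z]).
  by apply: cbmM; [exact: cbm_cst|exact: cbm_horner].
rewrite -XE -mulrA -XE; split.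
- rewrite /weyl /= mul0r addr0 -mulNr -ipZl//; last exact: cbm_horner.
  rewrite -ipDl//; try exact: cbm_horner; try exact: bC.
  apply: eq_Rintegral => z _; congr (complex.Re (_ * _)).
  by rewrite sfS !hornerE rmorphN /=; ring.
- rewrite /weyls -mulNr -ipZl//; last exact: cbm_horner.
  rewrite -ipDl//; try exact: cbm_horner; try exact: bC.
  apply: eq_Rintegral => z _; congr (complex.Re (_ * _)).
  by rewrite sgS !hornerE rmorphN /=; ring.
Qed.

Let ev_Xn i : ev ('X^i : {poly R[i]}) = fun z => circle_val z ^+ i.
Proof. by apply/funext => z; rewrite hornerXn. Qed.

(** Each expansion of the resolvent yields a factor r and a pairing of Phi_k with one of z, ..., z ^
    l, which vanishes as l < k. *)
Lemma weylE l k : (l < k)%N -> weyl k = r ^+ l * ip mu (ev (sf a k)) (G l).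
Proof.
have bk := cbm_horner (sf a k).
elim: l => [|l IHl] lk.
  by rewrite mul1r /weyl gtn_eqF// mul0r addr0.
rewrite IHl 1?ltnW// ip_G// -ev_Xn ipC sfO ?size_polyXn//.
by rewrite add0r mulrA -exprSr.
Qed.

(** Phi_k^* is orthogonal to z, ..., z ^ k, so k expansions are possible; on the circle Phi_k^*
    (conj z) ^ k is conj Phi_k, which leaves a Fourier coefficient of the resolvent. *)
Lemma weylsE k : weyls k = r ^+ k * ip mu (resolvent r) (ev (sf a k)).
Proof.
have bk := cbm_horner (sg a k).
have h i : (i <= k)%N -> weyls k = r ^+ i * ip mu (ev (sg a k)) (G i).
  elim: i => [|i IHi] ik; first by rewrite mul1r.
  rewrite IHi 1?ltnW// ip_G//.
  have -> : ip mu (ev (sg a k)) (fun z => circle_val z ^+ i.+1) = 0.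
    rewrite -[RHS](sfO ('X^(k - i.+1)) k); last by rewrite size_polyXn; lia.
    apply: eq_Rintegral => z _; rewrite szego_circle hornerXn rmorphXn /=.
    have -> : k = ((k - i.+1) + i.+1)%N by lia.
    rewrite addnK exprD; congr complex.Re.
    set w := circle_val z; set f := (sf _ _).[w].
    have wJi : w ^+ i.+1 * w^* ^+ i.+1 = 1 by rewrite -exprMn circle_valJ expr1n.
    by rewrite -[RHS]mulr1 -wJi; ring.
  by rewrite add0r mulrA -exprSr.
rewrite (h k)//; congr (_ * _); apply: eq_Rintegral => z _.
rewrite szego_circle /G conjCK; congr complex.Re.
have wJ : circle_val z ^+ k * (circle_val z)^* ^+ k = 1.
  by rewrite -exprMn circle_valJ expr1n.
by rewrite -[RHS]mul1r -wJ; ring.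
Qed.

Let sum_drop_norm (F : nat -> R) l n :
  \sum_(l <= k < n) F k ^+ 2 <= \sum_(l <= k < n) F k ^+ 2 / szego_norm a k.
Proof.
apply: ler_sum => k _; rewrite ler_peMr ?sqr_ge0//.
rewrite invr_ge1 ?szego_norm_le1 ?unitfE ?gt_eqF ?(szego_norm_gt0 mu c)//.
exact: (coef_lt1 mu c).
Qed.

Let bsf k : cbounded_meas (ev (sf a k)). Proof. exact: cbm_horner. Qed.

Lemma sum_weyl l n :
  \sum_(l.+1 <= k < n) (r ^- l * weyl k) ^+ 2 <= resolvent_norm.
Proof.
have rl : r ^+ l != 0 by rewrite expf_neq0// gt_eqF//; case/andP: r01.
rewrite -(ip_GG l) (le_trans _ (bessel mu (index_iota l.+1 n) (fun k => ev (sf a k))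
  (szego_norm a) (G l) _ _ _ _ _))//; last 3 first.
- exact: iota_uniq.
- exact: (szego_norm_gt0 mu c).
- exact: (ip_sf mu a sfO).
apply: le_trans (sum_drop_norm _ _ _); rewrite !big_nat; apply: ler_sum => k /andP[lk _].
by rewrite (weylE l)// mulKf// (ipC _ (G l)).
Qed.

Lemma sum_weyls l n :
  \sum_(l <= k < n) (r ^- k * weyls k) ^+ 2 <= resolvent_norm.
Proof.
have rk k : r ^+ k != 0 by rewrite expf_neq0// gt_eqF//; case/andP: r01.
rewrite (le_trans _ (bessel mu (index_iota l n) (fun k => ev (sf a k))
  (szego_norm a) (resolvent r) _ _ _ _ _))//; last 4 first.
- exact: iota_uniq.
- exact: cbm_resolvent.
- exact: (szego_norm_gt0 mu c).
- exact: (ip_sf mu a sfO).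
apply: le_trans (sum_drop_norm _ _ _); apply: ler_sum => k _.
by rewrite weylsE mulKf.
Qed.

Lemma weyl0 : weyl 0 = weyls 0 + r^-1.
Proof. by rewrite /weyl /weyls sf0 sg0 eqxx mul1r. Qed.

(** Both sides are the Poisson integral of mu at r, the right one being the real part of the
    Caratheodory function. *)
Lemma resolvent_norm_weyl : (1 - r ^+ 2) * resolvent_norm = 1 + 2 * r * weyls 0.
Proof.
have bK := cbm_resolvent r r01.
have -> : weyls 0 = \int[mu]_z complex.Re (resolvent r z).
  by apply: eq_Rintegral => z _; rewrite sg0 hornerC mul1r /G conjCK expr0 mul1r.
rewrite /resolvent_norm /ip -(intZ mu (1 - r ^+ 2)); last exact: bm_ip.
rewrite -(intZ mu (2 * r)); last by case: bK.
rewrite -[X in _ = X + _](int_cst mu 1) -intD; last 2 first.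
- exact: bm_cst.
- by apply: bmM; [exact: bm_cst|case: bK].
by apply: eq_Rintegral => z _; rewrite resolvent_poisson.
Qed.

(** The Poisson kernel has Lebesgue integral 1. *)
Lemma resolvent_norm_ge : c <= (1 - r ^+ 2) * resolvent_norm.
Proof.
have bK := cbm_resolvent r r01.
have r2 : 0 <= 1 - r ^+ 2 by case/andP: r01 => ? ?; nra.
have bP : bounded_meas (fun z => (1 - r ^+ 2) * complex.Re (resolvent r z * (resolvent r z)^*)).
  by apply: bmM; [exact: bm_cst|exact: bm_ip].
have h := mu_c _ bP (fun z => mulr_ge0 r2 (ReMJ_ge0 _)).
rewrite /resolvent_norm /ip -(intZ mu (1 - r ^+ 2)); last exact: bm_ip.
apply: le_trans h; rewrite -[leLHS]mulr1 ler_wpM2l ?(ltW c_gt0)//.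
rewrite le_eqVlt; apply/orP; left; apply/eqP.
transitivity (\int[circle_lebesgue R]_z (1 + 2 * r * complex.Re (resolvent r z))).
  rewrite intD; last 2 first.
  - exact: bm_cst.
  - by apply: bmM; [exact: bm_cst|case: bK].
  rewrite intZ; last by case: bK.
  by rewrite int_lebesgue_resolvent// mulr0 addr0 (int_cst (circle_lebesgue R)).
by apply: eq_Rintegral => z _; rewrite resolvent_poisson.
Qed.

End weyl.

(** * The two measures *)

Section pair.
Context {R : realType} (mu mu1 : probability (circle R) R) (c c1 : R).
Hypotheses (c_gt0 : 0 < c) (mu_c : minorized mu c).
Hypotheses (c1_gt0 : 0 < c1) (mu1_c : minorized mu1 c1).
Variable a : nat -> R.
Hypotheses (sfO : szego_orthogonal a mu) (sfO1 : szego_orthogonal (\- a) mu1).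

Section point.
Variable r : R.
Hypothesis r01 : 0 < r < 1.

Let sqr_le_sum (F : nat -> R) k l n B : (l <= k < n)%N ->
  \sum_(l <= j < n) F j ^+ 2 <= B -> F k ^+ 2 <= B.
Proof.
move=> lkn; apply: le_trans; rewrite (bigD1_seq k) ?iota_uniq ?mem_index_iota//=.
by rewrite lerDl sumr_ge0// => j _; exact: sqr_ge0.
Qed.

(* Both Weyl solutions decay like [r ^ k], whereas the Wronskian of two
   independent solutions is of order [r ^ k]. *)
Lemma caratheodory_mul :
  (1 + 2 * r * weyls mu a r 0) * (1 + 2 * r * weyls mu1 (\- a) r 0) = 1.
Proof.
have r0 : 0 < r by case/andP: r01.
pose M := resolvent_norm mu r; pose M1 := resolvent_norm mu1 r.
have s := weyl_solution mu a sfO r r01.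
have s1 := szego_solution_opp _ _ _ _ (weyl_solution mu1 (\- a) sfO1 r r01).
have s1' : szego_solution a r (\- weyl mu1 (\- a) r) (weyls mu1 (\- a) r).
  by move=> k; have := s1 k; rewrite /= opprK.
pose W0 := weyls mu a r 0 * - weyl mu1 (\- a) r 0 - weyl mu a r 0 * weyls mu1 (\- a) r 0.
have W k : weyls mu a r k * - weyl mu1 (\- a) r k - weyl mu a r k * weyls mu1 (\- a) r k =
  r ^+ k * szego_norm a k * W0 := wronskian a r _ _ _ _ k s s1'.
have W00 : W0 = 0.
  (* At index j + 1 the Wronskian is at least c r ^ (j + 1) |W0| in absolute value, while the four
     Weyl values bound it by r ^ (2 j) (M + M1). *)
  apply: (@geometric_vanish _ _ ((M + M1) / (c * r)) r) => // j.
  have y2 := sqr_le_sum _ j.+1 j.+1 j.+2 _ _ (sum_weyl mu c c_gt0 mu_c a sfO r r01 j j.+2).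
  have y12 := sqr_le_sum _ j.+1 j.+1 j.+2 _ _
    (sum_weyl mu1 c1 c1_gt0 mu1_c (\- a) sfO1 r r01 j j.+2).
  have ys2 := sqr_le_sum _ j.+1 j.+1 j.+2 _ _ (sum_weyls mu c c_gt0 mu_c a sfO r r01 j.+1 j.+2).
  have ys12 := sqr_le_sum _ j.+1 j.+1 j.+2 _ _
    (sum_weyls mu1 c1 c1_gt0 mu1_c (\- a) sfO1 r r01 j.+1 j.+2).
  have rj : 0 < r ^+ j by rewrite exprn_gt0.
  have := y2; have := y12; have := ys2; have := ys12; rewrite leqnn ltnSn -/M -/M1.
  set q := weyls mu1 _ _ _; set p := weyls mu _ _ _.
  set v := weyl mu1 _ _ _; set u := weyl mu _ _ _.
  move=> /(_ isT) hq /(_ isT) hp /(_ isT) hv /(_ isT) hu.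
  have e0 t B : (r ^- j * t) ^+ 2 <= B -> t ^+ 2 <= r ^+ j ^+ 2 * B.
    by rewrite exprMn exprVn mulrC ler_pdivrMr ?exprn_gt0// mulrC.
  have e1 t B : (r ^- j.+1 * t) ^+ 2 <= B -> t ^+ 2 <= r ^+ j ^+ 2 * B.
    rewrite exprMn exprVn mulrC ler_pdivrMr ?exprn_gt0// => h.
    apply: (le_trans h); rewrite mulrC ler_wpM2r ?(le_trans _ h)//.
      by move: h; rewrite -ler_pdivrMr ?exprn_gt0//; apply: le_trans; rewrite divr_ge0 ?sqr_ge0.
    by rewrite [r ^+ j.+1]exprS exprMn ler_piMl ?sqr_ge0//; case/andP: r01 => ? ?; nra.
  have {}hq := e1 _ _ hq; have {}hp := e1 _ _ hp.
  have {}hv := e0 _ _ hv; have {}hu := e0 _ _ hu.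
  have := W j.+1; rewrite /= -/p -/q -/u -/v => Wj.
  have N1 := szego_norm_ge mu c c_gt0 mu_c a sfO j.+1.
  have : c * r ^+ j.+1 * `|W0| <= r ^+ j ^+ 2 * (M + M1).
    apply: (@le_trans _ _ `|p * - v - u * q|).
      rewrite Wj normrM ler_wpM2r// normrM mulrC ler_pM ?(ltW c_gt0) ?exprn_ge0 ?(ltW r0)//.
        by rewrite ger0_norm// exprn_ge0// ltW.
      by rewrite ger0_norm// (le_trans _ N1)// ltW.
    rewrite mulrDr; apply/ler_normlP; split.
      have := sqr_ge0 (p - v); have := sqr_ge0 (u - q); nra.
    have := sqr_ge0 (p + v); have := sqr_ge0 (u + q); nra.
  rewrite exprS => h.
  rewrite -(ler_pM2l (mulr_gt0 (mulr_gt0 c_gt0 r0) rj)).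
  have -> : c * r * r ^+ j * ((M + M1) / (c * r) * r ^+ j) = r ^+ j ^+ 2 * (M + M1).
    by field; rewrite !gt_eqF.
  by rewrite -[c * r * _]mulrA.
(* With m, m1 the values of [weyls] at 0, W0 = 0 reads m + m1 + 2 r m m1 = 0, which is the claim
   expanded. *)
move: W00; rewrite /W0 /= !weyl0; set m := weyls mu _ _ _; set m1 := weyls mu1 _ _ _.
move=> h; have : r * (m * - (m1 + r^-1) - (m + r^-1) * m1) = 0 by rewrite h mulr0.
have -> : r * (m * - (m1 + r^-1) - (m + r^-1) * m1) = - (2 * r * m * m1 + m + m1).
  by field; rewrite gt_eqF.
nra.
Qed.

Lemma resolvent_norm_le : (1 - r ^+ 2) * resolvent_norm mu r <= c1^-1.
Proof.
rewrite (resolvent_norm_weyl mu a)//; have := caratheodory_mul.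
have h := resolvent_norm_ge mu1 c1 c1_gt0 mu1_c r r01.
rewrite (resolvent_norm_weyl mu1 (\- a))// in h.
move: h; set F1 := 1 + 2 * r * weyls mu1 _ _ _; set F := 1 + _ => h FF1.
have F1_gt0 : 0 < F1 by exact: lt_le_trans h.
have -> : F = F1^-1 by apply: (mulIf (lt0r_neq0 F1_gt0)); rewrite FF1 mulVf// gt_eqF.
by rewrite lef_pV2.
Qed.

End point.

Lemma geometric_le (q : R) n : 0 <= q -> (1 - q) * \sum_(j < n) q ^+ j <= 1.
Proof.
move=> q0; rewrite -opprB mulNr -subrX1 opprB lerBlDr lerDl exprn_ge0//.
Qed.

(** * Estimates at r = N / (N + 1) *)

Section interval.
Variables l n : nat.
Hypothesis ltln : (l < n)%N.
Let N : R := (n - l)%N%:R.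
Let r := N / (N + 1).

Let N_gt0 : 0 < N. Proof. by rewrite ltr0n subn_gt0. Qed.
Let N_ge1 : 1 <= N. Proof. by rewrite ler1n subn_gt0. Qed.

Let rE : 1 - r = (N + 1)^-1.
Proof. by have := N_gt0; rewrite /r => ?; field; rewrite gt_eqF//; lra. Qed.

Let r_gt0 : 0 < r.
Proof. by rewrite /r divr_gt0// addr_gt0. Qed.

Let r01 : 0 < r < 1.
Proof. by rewrite r_gt0 -subr_gt0 rE invr_gt0 addr_gt0. Qed.

Let rV : r^-1 = 1 + N^-1.
Proof. by rewrite /r; field; rewrite !gt_eqF// addr_gt0. Qed.

Let rVN : r^-1 ^+ (n - l) <= expR 1.
Proof.
rewrite rV; apply: (@le_trans _ _ (expR (N^-1) ^+ (n - l))).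
  by apply: lerXn2r; rewrite ?nnegrE ?expR_ge0 ?expR_ge1Dx ?addr_ge0 ?invr_ge0 ?(ltW N_gt0).
by rewrite -expRM_natl -/N mulfV ?gt_eqF.
Qed.

Let drop_norm k (t : R) : t ^+ 2 <= t ^+ 2 / szego_norm a k.
Proof.
rewrite ler_peMr ?sqr_ge0// invr_ge1 ?szego_norm_le1 ?unitfE ?gt_eqF ?(szego_norm_gt0 mu c)//.
exact: (coef_lt1 mu c).
Qed.

Let sum_ord_le (F : nat -> R) : (forall k, 0 <= F k) ->
  \sum_(l.+1 <= k < n.+1) F k <= \sum_(k < n.+1) F k.
Proof.
move=> F0; rewrite -(big_mkord xpredT F) (@big_cat_nat _ _ _ l.+1 0 n.+1)//=; last exact: leqW.
by rewrite lerDr sumr_ge0.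
Qed.

(** A common constant for the bounds on Phi_k^* (first term), Phi_k (second) and the Weyl solution
    (third). *)
Let C := c^-1 * expR 1 ^+ 4 + 2 / c + 2 / c1.

Let C1 : c^-1 * expR 1 ^+ 4 <= C.
Proof. by rewrite /C -addrA lerDl addr_ge0// divr_ge0// ltW. Qed.

Let C2 : 2 / c <= C.
Proof.
by rewrite /C addrAC lerDr addr_ge0// ?mulr_ge0 ?invr_ge0 ?exprn_ge0 ?expR_ge0// ltW.
Qed.

Let C3 : 2 / c1 <= C.
Proof.
by rewrite /C lerDr addr_ge0// ?mulr_ge0 ?invr_ge0 ?exprn_ge0 ?expR_ge0// ltW.
Qed.

Let N1 : N + 1 <= 2 * N. Proof. by have := N_ge1; lra. Qed.

(** The Christoffel bound at r, with the sum of r ^ (2 j) at most 1 / (1 - r) = N + 1 <= 2 N. *)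
Lemma sum_szego1 : \sum_(l.+1 <= k < n.+1) (szego a r k).1 ^+ 2 <= C * N.
Proof.
apply: (le_trans (sum_ord_le _ (fun k => sqr_ge0 _))).
apply: (@le_trans _ _ (\sum_(k < n.+1) (szego a r k).1 ^+ 2 / szego_norm a k)).
  by apply: ler_sum => k _.
apply: (le_trans (christoffel_le mu c c_gt0 mu_c a sfO r n.+1)).
apply: (@le_trans _ _ (2 / c * N)); last by rewrite ler_wpM2r// ltW.
rewrite (mulrC 2) -mulrA ler_wpM2l ?invr_ge0 ?(ltW c_gt0)// (le_trans _ N1)//.
have := geometric_le (r ^+ 2) n.+1 (sqr_ge0 _).
under eq_bigr do rewrite -exprM mulnC exprM.
set S := \sum_(_ < _) _ => h.
rewrite -[leLHS]mul1r -[X in X * _](mulfV (lt0r_neq0 (_ : 0 < N + 1))) ?addr_gt0//.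
rewrite -mulrA -[leRHS]mulr1 ler_wpM2l ?addr_ge0 ?(ltW N_gt0)// -rE.
apply: le_trans h; rewrite ler_wpM2r ?sumr_ge0// => [k _|]; first exact: sqr_ge0.
by case/andP: r01 => ? ?; nra.
Qed.

(** By reversal, the Christoffel bound at 1 / r with weight r ^ (2 l). The geometric sum is at most
    N r ^ (- 2 (n + 1)), and r ^ (l - n - 1) <= e ^ 2. *)
Lemma sum_szego2 : \sum_(l.+1 <= k < n.+1) (szego a r k).2 ^+ 2 <= C * N.
Proof.
have rn0 : r != 0 by rewrite gt_eqF.
have rl k : 0 <= r ^+ k by rewrite exprn_ge0// ltW.
apply: (@le_trans _ _ (\sum_(l.+1 <= k < n.+1)
    r ^+ l ^+ 2 * ((szego a r^-1 k).1 ^+ 2 / szego_norm a k))).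
  rewrite !big_nat; apply: ler_sum => k /andP[lk _].
  rewrite (szego_inv a r k rn0).2 exprMn ler_pM ?sqr_ge0//.
  rewrite lerXn2r ?nnegrE// ler_wiXn2l ?(ltW r_gt0) ?(ltnW lk)//.
  by case/andP: r01 => _ /ltW.
rewrite -mulr_sumr.
apply: (@le_trans _ _ (r ^+ l ^+ 2 * (c^-1 * \sum_(j < n.+1) (r^-1 ^+ j) ^+ 2))).
  rewrite ler_wpM2l ?sqr_ge0//.
  apply: le_trans (christoffel_le mu c c_gt0 mu_c a sfO r^-1 n.+1).
  apply: sum_ord_le => k; apply: le_trans (drop_norm k _); exact: sqr_ge0.
apply: (@le_trans _ _ (c^-1 * expR 1 ^+ 4 * N)); last by rewrite ler_wpM2r// ltW.
rewrite mulrCA -mulrA ler_wpM2l ?invr_ge0 ?(ltW c_gt0)//.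
set S := \sum_(_ < _) _.
have hS : S <= N * (r^-1 ^+ n.+1) ^+ 2.
  have e : (r^-1 ^+ 2 - 1) * S = r^-1 ^+ n.+1 ^+ 2 - 1.
    rewrite -[in RHS]exprM mulnC exprM [RHS]subrX1; congr (_ * _); apply: eq_bigr => j _.
    by rewrite -!exprM mulnC.
  have e2 : N^-1 * S <= (r^-1 ^+ 2 - 1) * S.
    rewrite ler_wpM2r ?sumr_ge0// => [k _|]; first exact: sqr_ge0.
    have ? : 0 < N^-1 by rewrite invr_gt0.
    by rewrite rV; nra.
  rewrite mulrC -ler_pdivrMr// mulrC (le_trans e2)// e lerBlDr lerDl//.
apply: (le_trans (ler_wpM2l (sqr_ge0 _) hS)).
rewrite mulrCA mulrC ler_wpM2r ?(ltW N_gt0)//.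
have -> : r ^+ l ^+ 2 * r^-1 ^+ n.+1 ^+ 2 = (r^-1 ^+ (n - l) * r^-1) ^+ 2.
  have -> : r^-1 ^+ n.+1 = r^-1 ^+ l * r^-1 ^+ (n - l).+1.
    by rewrite -exprD addnS subnKC// ltnW.
  have e : r ^+ l * r^-1 ^+ l = 1 by rewrite -exprMn mulfV// expr1n.
  by rewrite -exprMn mulrA e mul1r [r^-1 ^+ (n - l).+1]exprSr.
have -> : expR 1 ^+ 4 = (expR 1 ^+ 2) ^+ 2 :> R by rewrite -exprM.
have rV0 : 0 <= r^-1 by rewrite invr_ge0 ltW.
apply: lerXn2r; rewrite ?nnegrE ?mulr_ge0 ?exprn_ge0 ?expR_ge0//.
rewrite [leRHS]expr2; apply: ler_pM; rewrite ?exprn_ge0//.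
by apply: le_trans (expR_ge1Dx 1); rewrite rV lerD2l invf_le1.
Qed.

Lemma resolvent_norm_leN : resolvent_norm mu r <= C * N.
Proof.
apply: (@le_trans _ _ (2 / c1 * N)); last by rewrite ler_wpM2r// ltW.
have h := resolvent_norm_le r r01.
have h2 : (N + 1)^-1 * resolvent_norm mu r <= c1^-1.
  apply: le_trans h; rewrite ler_wpM2r ?ip_ge0// -rE.
  by case/andP: r01 => ? ?; nra.
rewrite (mulrC 2) -mulrA; apply: (@le_trans _ _ (c1^-1 * (N + 1))).
  by rewrite -ler_pdivrMr ?addr_gt0// mulrC.
by rewrite ler_wpM2l// invr_ge0 ltW.
Qed.

Lemma sum_expR_le_pair :
  (N^-1 * \sum_(l <= k < n) expR (2 * partial_sum a k)) *
  (N^-1 * \sum_(l <= k < n) expR (- 2 * partial_sum a k)) <=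
  (expR (4 * C / (c * (c / expR 1))) ^+ 2 * (16 * C / c) / (2 * (c / expR 1) * c)) ^+ 2.
Proof.
have e0 : 0 < expR 1 :> R by exact: expR_gt0.
have rl k : r ^+ k != 0 by rewrite expf_neq0// gt_eqF.
have sx : szego_solution a r (fun k => (szego a r k).1) (fun k => (szego a r k).2).
  by move=> k; rewrite szegoS /= mulrA.
have sy := weyl_solution mu a sfO r r01.
(* The Weyl solution is rescaled by r ^- l, so that its size and the Wronskian do not depend on the
   position of the interval. *)
apply: (sum_expR_le a c C _ l n (fun k => (szego a r k).1) (fun k => (szego a r k).2)
  (fun k => r ^- l * weyl mu a r k) (fun k => r ^- l * weyls mu a r k)) => //.
- exact: (coef_lt1 mu c).
- exact: (szego_norm_ge mu c).
- by rewrite divr_gt0.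
- exact: szego_solutionZ.
- exact: sum_szego1.
- exact: sum_szego2.
- apply: le_trans resolvent_norm_leN; exact: (sum_weyl mu c).
- apply: le_trans resolvent_norm_leN.
  apply: le_trans (sum_weyls mu c c_gt0 mu_c a sfO r r01 l.+1 n.+1).
  rewrite !big_nat; apply: ler_sum => k /andP[lk _].
  rewrite ![(_ * weyls _ _ _ _) ^+ 2]exprMn; apply: ler_wpM2r; first exact: sqr_ge0.
  have rk i : 0 < r ^+ i by rewrite exprn_gt0.
  apply: lerXn2r; rewrite ?nnegrE ?invr_ge0 ?(ltW (rk _))// lef_pV2 ?posrE//.
  rewrite ler_wiXn2l ?(ltW r_gt0) ?(ltnW lk)//.
  by case/andP: r01 => _ /ltW.
- move=> k /andP[lk kn]; have := wronskian a r _ _ _ _ k sx sy => /=.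
  rewrite weyl0 => Wk.
  have -> : (szego a r k).2 * (r ^- l * weyl mu a r k) -
      (szego a r k).1 * (r ^- l * weyls mu a r k) =
    r ^- l * ((szego a r k).2 * weyl mu a r k - (szego a r k).1 * weyls mu a r k) by ring.
  rewrite Wk.
  have -> : r ^- l * (r ^+ k * szego_norm a k *
      (1 * (weyls mu a r 0 + r^-1) - 1 * weyls mu a r 0)) =
     r ^+ (k - l.+1) * szego_norm a k.
    have -> : r ^+ k = r ^+ l * r * r ^+ (k - l.+1) by rewrite -exprSr -exprD subnKC.
    by field; rewrite rl gt_eqF.
  have Nk := szego_norm_ge mu c c_gt0 mu_c a sfO k.
  rewrite ger0_norm; last by rewrite mulr_ge0 ?exprn_ge0 ?(ltW r_gt0)// (le_trans _ Nk)// ltW.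
  rewrite mulrC ler_pM ?(ltW c_gt0) ?invr_ge0 ?(ltW e0)//.
  (* The origin of d = c / e: the Wronskian is r ^ (k - l - 1) times a squared norm at least c, and
     r ^ N >= 1 / e. *)
  apply: (@le_trans _ _ (r ^+ (n - l))).
    rewrite -[leRHS]invrK lef_pV2 ?posrE ?invr_gt0 ?exprn_gt0//.
    by rewrite -exprVn rVN.
  rewrite ler_wiXn2l ?(ltW r_gt0) ?leq_sub//.
  by case/andP: r01 => _ /ltW.
Qed.

End interval.
End pair.

Theorem theorem1 (R : realType) (mu mu1 : probability (circle R) R)
    (alpha : nat -> R)
    (nt_mu : nontrivial mu) (nt_mu1 : nontrivial mu1)
    (rc_mu : recurrence_coefficients mu (fun k => (alpha k)%:C))
    (rc_mu1 : recurrence_coefficients mu1 (fun k => (- alpha k)%:C))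
    (st_mu : steklov mu) (st_mu1 : steklov mu1) :
  (ereal_sup [set x : \bar R | exists n l : nat, (l < n)%N /\
     x = (((n - l)%N%:R^-1 * \sum_(l <= k < n) expR (2 * partial_sum alpha k)) *
          ((n - l)%N%:R^-1 *
             \sum_(l <= k < n) expR (- 2 * partial_sum alpha k)))%:E]
   < +oo)%E.
Proof.
have [c c0 mc] := steklov_minorized mu st_mu.
have [c1 c10 mc1] := steklov_minorized mu1 st_mu1.
have [Phi moP aP] := rc_mu; have [Phi1 moP1 aP1] := rc_mu1.
have O := monic_orthogonal_szego mu c c0 mc Phi moP alpha aP.
have O1 := monic_orthogonal_szego mu1 c1 c10 mc1 Phi1 moP1 (\- alpha) aP1.
apply: le_lt_trans (ltry _); apply: ge_ereal_sup => _ [n [l [ln ->]]].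
rewrite lee_fin; exact: (sum_expR_le_pair mu mu1 c c1).
Qed.
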